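(* Let $s\ge 1$ be an integer, $q_0=3^s$, $q=3q_0^2$, let $\mathbb K$ be an algebraically closed field of characteristic $3$, and let $\mathbb K(\mathcal R_q)=\mathbb K(x,y,z)$, with $y^q-y=x^{q_0}(x^q-x)$ and $z^q-z=x^{2q_0}(x^q-x)$, be the Ree function field, with full automorphism group $\operatorname{Ree}(q)={}^2G_2(q)$. Put $\vartheta=(x^q-x)^{q-1}$, $$B_R(T)=1+T^{q^2}+T^{q^2+3q_0q}-T^{q^2+3q_0q+q}+T^{q^2+3q_0q+2q}+T^{q^2+3q_0q+2q+3q_0}+T^{q^2+3q_0q+2q+3q_0+1},$$ $$t_R=\frac{B_R(\vartheta)^{q-3q_0+1}}{\vartheta^{q^3}}.$$ Then the fixed field of $\operatorname{Ree}(q)$ is $$\mathbb K(\mathcal R_q)^{\operatorname{Ree}(q)}=\mathbb K(t_R).$$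
   Context: The Ree curve $\mathcal R_q$ is the nonsingular model of the affine curve $y^q-y=x^{q_0}(x^q-x)$, $z^q-z=x^{2q_0}(x^q-x)$ over $\mathbb K$; its function field is $\mathbb K(\mathcal R_q)=\mathbb K(x,y,z)$. Its full group of $\mathbb K$-automorphisms is (isomorphic to) the Ree group $\operatorname{Ree}(q)={}^2G_2(q)$, of order $q^3(q-1)(q^3+1)$. Explicitly, put $w_1=x^{3q_0+1}-y^{3q_0}$, $w_2=xy^{3q_0}-z^{3q_0}$, $w_3=xz^{3q_0}-w_1^{3q_0}$, $w_4=xw_2^{q_0}-yw_1^{q_0}$, $v=xw_3^{q_0}-zw_1^{q_0}$, $w_5=yw_3^{q_0}-zw_2^{q_0}$, $w_6=v^{3q_0}-w_2^{3q_0}+xw_4^{3q_0}$, $w_7=w_2+v$, $w_8=w_5^{3q_0}+xw_7^{3q_0}$, $w_9=w_4w_2^{q_0}-yw_6^{q_0}$, $w_{10}=zw_6^{q_0}-w_3^{q_0}w_4$. The group is generated by the $\mathbb K$-automorphisms $x\mapsto ax+b$, $y\mapsto a^{q_0+1}y+ab^{q_0}x+c$, $z\mapsto a^{2q_0+1}z-a^{q_0+1}b^{q_0}y+ab^{2q_0}x+d$ with $a\in\mathbb F_q^*$, $b,c,d\in\mathbb F_q$, together with the involution $\phi: x\mapsto w_6/w_8,\ y\mapsto w_{10}/w_8,\ z\mapsto w_9/w_8$. For a group $G$ of automorphisms of a field $F$, $F^G$ denotes the fixed field. *)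

(* Defs.v *)
From HB Require Import structures.
From mathcomp Require Import all_boot all_order all_algebra.

Set Implicit Arguments.
Unset Strict Implicit.
Unset Printing Implicit Defensive.

Import GRing.Theory.
Local Open Scope ring_scope.

(* [adjoin iota gs u] : u lies in the subfield K(gs) of F generated by the
   constants iota(K) and the elements of gs.  The inverse is total, with
   0^-1 = 0, so the inversion clause needs no side condition. *)
Inductive adjoin (K F : fieldType) (iota : {rmorphism K -> F}) (gs : seq F) :
    F -> Prop :=
| adjoin_const k : adjoin iota gs (iota k)
| adjoin_gen g : g \in gs -> adjoin iota gs g
| adjoinD u v : adjoin iota gs u -> adjoin iota gs v -> adjoin iota gs (u + v)
| adjoinN u : adjoin iota gs u -> adjoin iota gs (- u)
| adjoinM u v : adjoin iota gs u -> adjoin iota gs v -> adjoin iota gs (u * v)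
| adjoinV u : adjoin iota gs u -> adjoin iota gs u^-1.

(* The field F with generators x, y, z over K is determined up to
   K-isomorphism by these conditions: the equations define an absolutely
   irreducible affine curve, i.e. [K(x, y, z) : K(x)] = q ^ 2 whenever x is
   transcendental over K. *)
Record ree_function_field (K F : fieldType) (iota : {rmorphism K -> F})
    (q0 q : nat) (x y z : F) : Prop := ReeFunctionField {
  ree_x_transcendental : ~ algebraicOver iota x;
  ree_y_eq : y ^+ q - y = x ^+ q0 * (x ^+ q - x);
  ree_z_eq : z ^+ q - z = x ^+ (2 * q0) * (x ^+ q - x);
  ree_generated : forall u : F, adjoin iota [:: x; y; z] u
}.

Definition is_Kautomorphism (K F : fieldType) (iota : {rmorphism K -> F})
    (sigma : {rmorphism F -> F}) : Prop :=
  bijective sigma /\ forall k : K, sigma (iota k) = iota k.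

(* F_q is the set of the roots of T ^ q - T in K. *)
Definition is_ree_affine (K F : fieldType) (iota : {rmorphism K -> F})
    (q0 q : nat) (x y z : F) (sigma : F -> F) : Prop :=
  exists a b c d : K,
    [/\ [/\ a != 0, a ^+ q = a, b ^+ q = b, c ^+ q = c & d ^+ q = d],
        sigma x = iota a * x + iota b,
        sigma y = iota (a ^+ (q0 + 1)) * y + iota (a * b ^+ q0) * x + iota c
      & sigma z = iota (a ^+ (2 * q0 + 1)) * z
                  - iota (a ^+ (q0 + 1) * b ^+ q0) * y
                  + iota (a * b ^+ (2 * q0)) * x + iota d].

Definition is_ree_involution (F : fieldType) (q0 : nat) (x y z : F)
    (sigma : F -> F) : Prop :=
  let w1 := x ^+ (3 * q0 + 1) - y ^+ (3 * q0) in
  let w2 := x * y ^+ (3 * q0) - z ^+ (3 * q0) in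
  let w3 := x * z ^+ (3 * q0) - w1 ^+ (3 * q0) in
  let w4 := x * w2 ^+ q0 - y * w1 ^+ q0 in
  let v := x * w3 ^+ q0 - z * w1 ^+ q0 in
  let w5 := y * w3 ^+ q0 - z * w2 ^+ q0 in
  let w6 := v ^+ (3 * q0) - w2 ^+ (3 * q0) + x * w4 ^+ (3 * q0) in
  let w7 := w2 + v in
  let w8 := w5 ^+ (3 * q0) + x * w7 ^+ (3 * q0) in
  let w9 := w4 * w2 ^+ q0 - y * w6 ^+ q0 in
  let w10 := z * w6 ^+ q0 - w3 ^+ q0 * w4 in
  [/\ sigma x = w6 / w8, sigma y = w10 / w8 & sigma z = w9 / w8].

(* The subgroup of Aut_K(F) generated by the K-automorphisms of affine type
   and the involution. *)
Inductive ree_group (K F : fieldType) (iota : {rmorphism K -> F})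
    (q0 q : nat) (x y z : F) : (F -> F) -> Prop :=
| ree_affine (sigma : {rmorphism F -> F}) :
    is_Kautomorphism iota sigma ->
    is_ree_affine iota q0 q x y z sigma ->
    ree_group iota q0 q x y z sigma
| ree_involution (sigma : {rmorphism F -> F}) :
    is_Kautomorphism iota sigma ->
    is_ree_involution q0 x y z sigma ->
    ree_group iota q0 q x y z sigma
| ree_id : ree_group iota q0 q x y z id
| ree_comp (f g : F -> F) :
    ree_group iota q0 q x y z f -> ree_group iota q0 q x y z g ->
    ree_group iota q0 q x y z (f \o g)
| ree_inv (f g : F -> F) :
    ree_group iota q0 q x y z f -> cancel f g -> cancel g f ->
    ree_group iota q0 q x y z g.

Definition fixed_by (F : Type) (G : (F -> F) -> Prop) (u : F) : Prop :=
  forall f : F -> F, G f -> f u = u.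

Definition ree_B (R : nzRingType) (q0 q : nat) : {poly R} :=
  1 + 'X^(q ^ 2) + 'X^(q ^ 2 + 3 * q0 * q) - 'X^(q ^ 2 + 3 * q0 * q + q)
  + 'X^(q ^ 2 + 3 * q0 * q + 2 * q)
  + 'X^(q ^ 2 + 3 * q0 * q + 2 * q + 3 * q0)
  + 'X^(q ^ 2 + 3 * q0 * q + 2 * q + 3 * q0 + 1).

Definition ree_theta (F : fieldType) (q : nat) (x : F) : F :=
  (x ^+ q - x) ^+ (q - 1).

(* The truncated subtraction q - 3 * q0 is exact for q = 3 * q0 ^ 2, q0 > 0. *)
Definition ree_t (F : fieldType) (q0 q : nat) (x : F) : F :=
  (ree_B F q0 q).[ree_theta q x] ^+ (q - 3 * q0 + 1)
  / ree_theta q x ^+ (q ^ 3).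

(* Main.v *)
(* Writing D = x^q - x and theta = D^(q-1), let P = (1, x, w1, w2, w3, w6, w8),
   a point of the quadric w8 + x w6 + w1 w3 = w2^2, with polar form <,>.  With
   m = (q+1)(q+3q0+1), the curve equations give <P, P^(q^3)> = D^m and
   <P, P^(q^4)> = D^m B_R(theta).  The involution phi sends P, up to signs, to
   (w8, w6, w3, w2, w1, x, 1) / w8, an isometry up to scaling, and D to
   D / w8^(q-3q0+1); hence phi fixes t_R, which the affine maps fix as well.

   All these maps do extend to automorphisms: for c^q = - c, the element
   w = y + c z generates F over K(x) by an Artin-Schreier equation of degree q^2
   that stays irreducible (otherwise h^3 - d^2 h = w^(q^2) - w would have a
   solution in K(x), against a degree count modulo 3), so any transcendental
   point of the curve defines an endomorphism of F; it is onto if it fixes t_R,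
   since F is algebraic over K(t_R).

   An invariant u is then pushed down F, K(x, y), K(x), K(theta), K(t_R): at each
   step the generator has as many conjugates as its degree, so u, a polynomial
   of smaller degree in the generator, is constant.  The q^3 + 1 conjugates of
   theta over K(t_R) are theta and the images of phi(theta) under the
   translations; they are distinct because the translates of w8 are pairwise
   non-proportional over K. *)
Require Import Defs.
From HB Require Import structures.
From Stdlib Require Import Ring Ring_theory PArith.Pnat.
From mathcomp Require Import all_boot all_order all_algebra.
From mathcomp Require Import separable boolp zify.

Set Implicit Arguments.
Unset Strict Implicit.
Unset Printing Implicit Defensive.

Import GRing.Theory.
Local Open Scope ring_scope.

(** * A ring tactic in characteristic 3 *)

(** The exponents in t_R come from weights. Under phi a form <P, P^n> is divided by w8^(n+1), so
    B_R(theta), the quotient of the forms at q^4 and q^3, is multiplied by w8^(q^3 - q^4), while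
    theta^(q^3) is divided by w8^((q-3q0+1)(q-1)q^3); raising B_R to the power q-3q0+1 balances the
    two. Since q = 3q0^2, the product (q+1)(q+3q0+1)(q-3q0+1) equals q^3+1, so t_R has degree q^3+1
    in theta.

    The two inclusions differ in nature. That K(t_R) is fixed is an induction over the generators.
    The converse needs enough group elements, and the group contains only maps that are
    automorphisms of F: these must be constructed from the equations and the transcendence of x
    alone, which is why irreducibility has to be proved. The descent then computes no degrees: at
    each level a polynomial bounding the degree from above meets equally many distinct
    conjugates. *)

Inductive f3 := F0 | F1 | F2.
Definition f3add a b :=
  match a, b with
  | F0, c => c | c, F0 => c | F1, F1 => F2 | F2, F2 => F1 | _, _ => F0
  end.
Definition f3opp a := match a with F0 => F0 | F1 => F2 | F2 => F1 end.
Definition f3mul a b :=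
  match a, b with
  | F0, _ => F0 | _, F0 => F0 | F1, c => c | c, F1 => c | F2, F2 => F1
  end.
Definition f3eq a b :=
  match a, b with F0, F0 | F1, F1 | F2, F2 => true | _, _ => false end.

Section R.
Variable R : comNzRingType.
Hypothesis ch : 3%nat \in [pchar R].
Let T : Type := R.
Definition r3zero : T := 0.
Definition r3one : T := 1.
Definition r3add (a b : T) : T := a + b.
Definition r3mul (a b : T) : T := a * b.
Definition r3opp (a : T) : T := - a.
Definition r3sub (a b : T) : T := a - b.
Definition r3exp (a : T) n : T := a ^+ n.
Definition f3to a : T := match a with F0 => r3zero | F1 => r3one | F2 => r3opp r3one end.

Lemma r3_theory : ring_theory r3zero r3one r3add r3mul r3sub r3opp eq.
Proof.
by split=> //; [exact: add0r|exact: addrC|exact: addrA|exact: mul1r|exact: mulrC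
  |exact: mulrA|exact: mulrDl|exact: subrr].
Qed.

Lemma pchar3_1D1 : 1 + 1 = -1 :> R.
Proof. by apply/eqP; rewrite -subr_eq0 opprK -mulr2n -mulrSr; apply/eqP/(pcharf0 ch). Qed.

(** With coefficients in this three-element ring, [ring] decides 3 = 0 by evaluation, so identities
    valid only in characteristic 3 need no manual rewriting. *)
Lemma f3_morph :
  ring_morph r3zero r3one r3add r3mul r3sub r3opp eq
    F0 F1 f3add f3mul (fun a b => f3add a (f3opp b)) f3opp f3eq f3to.
Proof.
rewrite /f3to /r3zero /r3one /r3add /r3mul /r3opp.
split=> //; [| | |by case; rewrite /= ?oppr0 ?opprK|by case=> //; case].
all: move=> [] [] //=; rewrite /r3sub ?(addr0, add0r, subr0, sub0r, subrr, addNr,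
  opprK, mulr0, mul0r, mulr1, mul1r, mulrN, mulNr, pchar3_1D1, oppr0) //.
all: by rewrite -?opprD ?pchar3_1D1 ?opprK.
Qed.

Lemma r3_power : power_theory r3one r3mul eq BinNat.N.to_nat r3exp.
Proof.
split=> r; case=> //= p; rewrite /r3exp; elim: p => [p IH|p IH|] /=.
- by rewrite Pnat.Pos2Nat.inj_xI exprS -IH multE mul2n -addnn exprD.
- by rewrite Pnat.Pos2Nat.inj_xO -IH multE mul2n -addnn exprD.
- by rewrite expr1.
Qed.
End R.

Ltac r3_constant t :=
  match t with
  | r3one _ => F1
  | r3zero _ => F0
  | _ => constr:(InitialRing.NotConstant)
  end.
Ltac r3_nat t :=
  match t with
  | O => constr:(BinNums.N0)
  | S ?n => let k := r3_nat n in
      match k with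
      | InitialRing.NotConstant => k
      | _ => eval vm_compute in (BinNat.N.succ k)
      end
  | _ => constr:(InitialRing.NotConstant)
  end.
(* Distinct instance paths of the same operation are syntactically different;
   folding them into r3add, r3mul, ... makes them visible to [ring]. *)
Ltac r3_fold R t :=
  match t with
  | @Algebra.add _ ?a ?b =>
      let a' := r3_fold R a in let b' := r3_fold R b in constr:(@r3add R a' b')
  | @GRing.mul _ ?a ?b =>
      let a' := r3_fold R a in let b' := r3_fold R b in constr:(@r3mul R a' b')
  | @Algebra.opp _ ?a => let a' := r3_fold R a in constr:(@r3opp R a')
  | @GRing.exp _ ?a ?n => let a' := r3_fold R a in constr:(@r3exp R a' n)
  | @GRing.one _ => constr:(r3one R)
  | @Algebra.zero _ => constr:(r3zero R)
  | _ => t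
  end.
Ltac ring3_in R :=
  match goal with
  | |- @eq _ ?a ?b =>
      let a' := r3_fold R a in let b' := r3_fold R b in
      change (@eq (GRing.ComNzRing.sort R) a' b'); first [ring | symmetry; ring]
  end.

(* Only now, because it shadows the Stdlib tactic [ring] used by [ring3_in]. *)
From mathcomp Require Import ring.

(** * Identities on the Ree curve *)

Section Functions.
Variables (F : fieldType) (q0 : nat) (x y z : F).
(** The functions bound by [let] in [is_ree_involution], with the point as a parameter so that they
    can also be evaluated at its images. *)
Definition ree_w1 : F := x ^+ (3 * q0 + 1) - y ^+ (3 * q0).
Definition ree_w2 : F := x * y ^+ (3 * q0) - z ^+ (3 * q0).
Definition ree_w3 : F := x * z ^+ (3 * q0) - ree_w1 ^+ (3 * q0).
Definition ree_w4 : F := x * ree_w2 ^+ q0 - y * ree_w1 ^+ q0.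
Definition ree_v : F := x * ree_w3 ^+ q0 - z * ree_w1 ^+ q0.
Definition ree_w5 : F := y * ree_w3 ^+ q0 - z * ree_w2 ^+ q0.
Definition ree_w6 : F :=
  ree_v ^+ (3 * q0) - ree_w2 ^+ (3 * q0) + x * ree_w4 ^+ (3 * q0).
Definition ree_w7 : F := ree_w2 + ree_v.
Definition ree_w8 : F := ree_w5 ^+ (3 * q0) + x * ree_w7 ^+ (3 * q0).
Definition ree_w9 : F := ree_w4 * ree_w2 ^+ q0 - y * ree_w6 ^+ q0.
Definition ree_w10 : F := z * ree_w6 ^+ q0 - ree_w3 ^+ q0 * ree_w4.
End Functions.

(** Only the equations are kept: the identities below apply alike to the generic point and to its
    images under the involution and the translations. *)
Record ree_point (F : fieldType) (q0 q : nat) (x y z : F) : Prop := ReePoint {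
  ree_point_y : y ^+ q - y = x ^+ q0 * (x ^+ q - x);
  ree_point_z : z ^+ q - z = x ^+ (2 * q0) * (x ^+ q - x)
}.

Section Frobenius.
Variables (F : fieldType) (n : nat).
Hypothesis hn : [pchar F].-nat n.

Lemma frobD (u v : F) : (u + v) ^+ n = u ^+ n + v ^+ n.
Proof. exact: exprDn_pchar. Qed.
Lemma frobN (u : F) : (- u) ^+ n = - u ^+ n.
Proof. exact: exprNn_pchar. Qed.
Lemma frobM (u v : F) : (u * v) ^+ n = u ^+ n * v ^+ n.
Proof. exact: exprMn. Qed.
Lemma frob2 (u : F) : (u ^+ 2) ^+ n = (u ^+ n) ^+ 2.
Proof. exact: exprAC. Qed.
Lemma frob3 (u : F) : (u ^+ 3) ^+ n = (u ^+ n) ^+ 3.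
Proof. exact: exprAC. Qed.
End Frobenius.

(** * Polynomial identities between the coordinates of a point *)

Section Curve.
Variables (F : fieldType) (q0 q : nat) (x y z : F).
Hypothesis ch : 3%N \in [pchar F].
Hypothesis q0n : [pchar F].-nat q0.
Hypothesis hq : q = (3 * q0 ^ 2)%N.
Hypothesis hP : ree_point q0 q x y z.

Add Ring F3_ring : (r3_theory F)
  (morphism (f3_morph ch), constants [r3_constant], power_tac (r3_power F) [r3_nat]).
Ltac ring3 := ring3_in F.

Lemma pnat3 : [pchar F].-nat 3%N.
Proof. by rewrite pnatE. Qed.

Lemma pnat_q : [pchar F].-nat q.
Proof. by rewrite hq pnatM pnat3 pnatX q0n. Qed.

Lemma expr_3q0 (u : F) : u ^+ (3 * q0) = (u ^+ q0) ^+ 3.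
Proof. by rewrite mulnC exprM. Qed.

Lemma expr_q0_q0_3 (u : F) : ((u ^+ q0) ^+ q0) ^+ 3 = u ^+ q.
Proof. by rewrite -!exprM hq; congr (_ ^+ _); rewrite mulnA mulnn mulnC. Qed.

Local Notation X := (x ^+ q0).
Local Notation Y := (y ^+ q0).
Local Notation Z := (z ^+ q0).
Local Notation D := (x ^+ q - x).
Local Notation w1 := (ree_w1 q0 x y).
Local Notation w2 := (ree_w2 q0 x y z).
Local Notation w3 := (ree_w3 q0 x y z).
Local Notation w4 := (ree_w4 q0 x y z).
Local Notation v := (ree_v q0 x y z).
Local Notation w5 := (ree_w5 q0 x y z).
Local Notation w6 := (ree_w6 q0 x y z).
Local Notation w7 := (ree_w7 q0 x y z).
Local Notation w8 := (ree_w8 q0 x y z).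
Local Notation w9 := (ree_w9 q0 x y z).
Local Notation w10 := (ree_w10 q0 x y z).

Let xq : x ^+ q = x + D.
Proof. by rewrite addrC subrK. Qed.
Let yq : y ^+ q = y + X * D.
Proof. by apply/eqP; rewrite addrC -subr_eq (ree_point_y hP). Qed.
Let zq : z ^+ q = z + X ^+ 2 * D.
Proof. by apply/eqP; rewrite addrC -subr_eq (ree_point_z hP) mulnC exprM. Qed.

Let fE := (frobD q0n, frobN q0n, @frobM F q0, @frob2 F q0, @frob3 F q0,
  frobD pnat3, frobN pnat3, @frobM F 3, @frob2 F 3, expr_q0_q0_3).

Lemma ree_w1E : w1 = x * X ^+ 3 - Y ^+ 3.
Proof. by rewrite /ree_w1 addn1 exprS !expr_3q0. Qed.

Lemma ree_w2E : w2 = x * Y ^+ 3 - Z ^+ 3.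
Proof. by rewrite /ree_w2 !expr_3q0. Qed.

(** Since 3 q0 * q0 = q, a q0-th power of [w1] involves only X, x^q and y^q, and the curve equations
    make the terms in D cancel. In the same way all the w's and their q0-th powers become
    polynomials in x, y, z, X, Y, Z, after which the identities are checked with X, Y, Z as
    independent variables. *)
Lemma ree_w1_q0 : w1 ^+ q0 = x * X - y.
Proof. rewrite ree_w1E !fE xq yq; move: X D => *; ring3. Qed.

Lemma ree_w2_q0 : w2 ^+ q0 = X * y - z.
Proof. rewrite ree_w2E !fE zq yq; move: X D => *; ring3. Qed.

Lemma ree_w3E : w3 = x * Z ^+ 3 - (x * X - y) ^+ 3.
Proof. by rewrite /ree_w3 !expr_3q0 ree_w1_q0. Qed.

Lemma ree_w3_q0 : w3 ^+ q0 = X * z - w1.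
Proof. rewrite ree_w3E ree_w1E !fE zq xq; move: X Y D => *; ring3. Qed.

Lemma ree_w4E : w4 = y * y - x * z.
Proof. rewrite /ree_w4 ree_w1_q0 ree_w2_q0; ring3. Qed.

Lemma ree_vE : v = y * z - x * w1.
Proof. rewrite /ree_v ree_w1_q0 ree_w3_q0; ring3. Qed.

Lemma ree_w5E : w5 = z * z - y * w1.
Proof. rewrite /ree_w5 ree_w2_q0 ree_w3_q0; ring3. Qed.

Lemma ree_w4_q0 : w4 ^+ q0 = Y * Y - X * Z.
Proof. by rewrite ree_w4E !fE. Qed.

Lemma ree_v_q0 : v ^+ q0 = Y * Z - X * (x * X - y).
Proof. by rewrite ree_vE frobD // frobN // !exprMn ree_w1_q0. Qed.

Lemma ree_w5_q0 : w5 ^+ q0 = Z * Z - Y * (x * X - y).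
Proof. by rewrite ree_w5E frobD // frobN // !exprMn ree_w1_q0. Qed.

Lemma ree_w7_q0 : w7 ^+ q0 = X * y - z + (Y * Z - X * (x * X - y)).
Proof. by rewrite (frobD q0n) ree_v_q0 ree_w2_q0. Qed.

Lemma ree_w6E : w6 = (v ^+ q0 - w2 ^+ q0) ^+ 3 + x * (w4 ^+ q0) ^+ 3.
Proof. by rewrite /ree_w6 !expr_3q0 (frobD pnat3) (frobN pnat3). Qed.

Lemma ree_w8E : w8 = (w5 ^+ q0) ^+ 3 + x * (w7 ^+ q0) ^+ 3.
Proof. by rewrite /ree_w8 !expr_3q0. Qed.

Lemma ree_w6_q0 : w6 ^+ q0 = v - w2 + X * w4.
Proof.
rewrite ree_w6E ree_v_q0 ree_w2_q0 ree_w4_q0 ree_vE ree_w2E ree_w4E ree_w1E.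
rewrite !fE yq zq xq; move: X Y Z D => *; ring3.
Qed.

Lemma ree_w8_q0 : w8 ^+ q0 = w5 + X * w7.
Proof.
rewrite ree_w8E ree_w5_q0 ree_w7_q0 /ree_w7 ree_vE ree_w5E ree_w2E ree_w1E.
rewrite !fE yq zq xq; move: X Y Z D => *; ring3.
Qed.

Lemma ree_w9E : w9 = - (w4 * z) - y * (v - w2).
Proof. rewrite /ree_w9 ree_w2_q0 ree_w6_q0; ring3. Qed.

Lemma ree_w10E : w10 = z * (v - w2) + w1 * w4.
Proof. rewrite /ree_w10 ree_w3_q0 ree_w6_q0; ring3. Qed.


Lemma ree_w9_q0 : w9 ^+ q0 = - (w4 ^+ q0 * Z) - Y * (v ^+ q0 - w2 ^+ q0).
Proof. by rewrite ree_w9E !fE. Qed.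

Lemma ree_w10_q0 : w10 ^+ q0 = Z * (v ^+ q0 - w2 ^+ q0) + w1 ^+ q0 * w4 ^+ q0.
Proof. by rewrite ree_w10E !fE. Qed.

Definition ree_q0E := (ree_w9_q0, ree_w10_q0, ree_w6_q0, ree_w8_q0, ree_w1_q0,
  ree_w2_q0, ree_w3_q0, ree_w4_q0, ree_v_q0, ree_w5_q0, ree_w7_q0).
Definition ree_cubeE := (ree_w6E, ree_w8E, ree_w9E, ree_w10E).
Definition ree_polyE := (ree_w3E, ree_w4E, ree_w5E, ree_vE, ree_w2E, ree_w1E).
Ltac ree_ring :=
  rewrite ?ree_q0E ?ree_cubeE ?ree_q0E /ree_w7 ?ree_polyE; move: X Y Z => *; ring3.

(* w6, w8, w1, w2, w3, x and 1 all have the form r ^ 3 + x * s ^ 3, so an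
   identity between their multiples by cubes splits into two cube roots. *)
Let cube_comb (r1 s1 r2 s2 r3 s3 k l m : F) :
  r1 * k - r2 * l = r3 * m -> s1 * k - s2 * l = s3 * m ->
  (r1 ^+ 3 + x * s1 ^+ 3) * k ^+ 3 - (r2 ^+ 3 + x * s2 ^+ 3) * l ^+ 3 =
  (r3 ^+ 3 + x * s3 ^+ 3) * m ^+ 3.
Proof.
move=> h1 h2; transitivity ((r3 * m) ^+ 3 + x * (s3 * m) ^+ 3); last by ring3.
rewrite -h1 -h2; ring3.
Qed.

Let w1_split : w1 = (- Y) ^+ 3 + x * X ^+ 3. Proof. ree_ring. Qed.
Let w2_split : w2 = (- Z) ^+ 3 + x * Y ^+ 3. Proof. ree_ring. Qed.
Let w3_split : w3 = (y - x * X) ^+ 3 + x * Z ^+ 3. Proof. ree_ring. Qed.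
Let x_split : x = 0 ^+ 3 + x * 1 ^+ 3. Proof. ring3. Qed.
Let one_split : 1 = 1 ^+ 3 + x * 0 ^+ 3. Proof. ring3. Qed.


Let w6_split : w6 = (v ^+ q0 - w2 ^+ q0) ^+ 3 + x * (w4 ^+ q0) ^+ 3.
Proof. exact: ree_w6E. Qed.
Let w8_split : w8 = (w5 ^+ q0) ^+ 3 + x * (w7 ^+ q0) ^+ 3.
Proof. exact: ree_w8E. Qed.

(** Divided by w8 * w8^(3 q0), the cubic identities give w1, w2, w3, w6 and w8 at the image point of
    the involution. The quadratic ones below give its curve equations and w4, v, w5 there. *)
Lemma ree_cubic1 :
  w6 * (w6 ^+ q0) ^+ 3 - w8 * (w10 ^+ q0) ^+ 3 = w3 * (w8 ^+ q0) ^+ 3.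
Proof. rewrite {1}w6_split {1}w8_split w3_split; apply: cube_comb; ree_ring. Qed.

Lemma ree_cubic2 :
  w6 * (w10 ^+ q0) ^+ 3 - w8 * (w9 ^+ q0) ^+ 3 = - w2 * (w8 ^+ q0) ^+ 3.
Proof.
suff : w6 * (w10 ^+ q0) ^+ 3 - w8 * (w9 ^+ q0) ^+ 3 = w2 * (- w8 ^+ q0) ^+ 3.
  by rewrite (frobN pnat3) mulrN mulNr.
rewrite {1}w6_split {1}w8_split [w2 in RHS]w2_split; apply: cube_comb; ree_ring.
Qed.

Lemma ree_cubic3 :
  w6 * (w9 ^+ q0) ^+ 3 - w8 * (w3 ^+ q0) ^+ 3 = w1 * (w8 ^+ q0) ^+ 3.
Proof.
rewrite {1}w6_split {1}w8_split [w1 in RHS]w1_split; apply: cube_comb; ree_ring.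
Qed.

Lemma ree_cubic6 :
  w6 * (w5 ^+ q0) ^+ 3 - w8 * (v ^+ q0 - w2 ^+ q0) ^+ 3 = x * (w8 ^+ q0) ^+ 3.
Proof.
transitivity ((0 ^+ 3 + x * 1 ^+ 3) * (w8 ^+ q0) ^+ 3); last by rewrite -x_split.
rewrite {1}w6_split {1}w8_split; apply: cube_comb; ree_ring.
Qed.

Lemma ree_cubic8 :
  w8 * (w4 ^+ q0) ^+ 3 - w6 * (w7 ^+ q0) ^+ 3 = (w8 ^+ q0) ^+ 3.
Proof.
transitivity ((1 ^+ 3 + x * 0 ^+ 3) * (w8 ^+ q0) ^+ 3).
  by rewrite {1}w6_split {1}w8_split; apply: cube_comb; ree_ring.
by rewrite -one_split mul1r.
Qed.

Lemma ree_quadratic_y : w6 * w6 ^+ q0 - w10 * w8 ^+ q0 = w3 ^+ q0 * w8.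
Proof. ree_ring. Qed.
Lemma ree_quadratic_z : w6 ^+ q0 * w10 - w8 ^+ q0 * w9 = - w2 ^+ q0 * w8.
Proof. ree_ring. Qed.
Lemma ree_quadratic4 : w10 * w10 - w6 * w9 = w5 * w8.
Proof. ree_ring. Qed.
Lemma ree_quadratic_v : w10 * w9 - w6 * w3 = - v * w8.
Proof. ree_ring. Qed.
Lemma ree_quadratic5 : w9 * w9 - w10 * w3 = w4 * w8.
Proof. ree_ring. Qed.

Lemma ree_w6_q : w6 ^+ q = w6 + D * (w4 ^+ q0) ^+ 3.
Proof.
rewrite -expr_q0_q0_3 ree_w6_q0 !fE xq [in RHS]ree_w6E !fE; move: D => *; ring3.
Qed.

Lemma ree_w8_q : w8 ^+ q = w8 + D * (w7 ^+ q0) ^+ 3.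
Proof.
rewrite -expr_q0_q0_3 ree_w8_q0 !fE xq [in RHS]ree_w8E !fE; move: D => *; ring3.
Qed.

Lemma ree_quadric : w8 + x * w6 + w1 * w3 = w2 * w2.
Proof. ree_ring. Qed.

(* The bilinear form polar to [ree_quadric], at the point
   (1, x, w1, w2, w3, w6, w8) of P^6 and its image under u |-> u ^+ n
   (-2 = 1 gives the middle coefficient). *)
Definition ree_form (n : nat) : F :=
  w8 ^+ n + x * w6 ^+ n + w1 * w3 ^+ n + w2 * w2 ^+ n + w3 * w1 ^+ n
  + w6 * x ^+ n + w8.

(** * Frobenius chains and the values of the form at q^3 and q^4 *)

Local Notation E := (D ^+ (3 * q0)).
Let tq : (x ^+ q) ^+ q = x ^+ q + D ^+ q.
Proof. by rewrite {1}xq (frobD pnat_q). Qed.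
Let X3q : (X ^+ q) ^+ 3 = X ^+ 3 + E.
Proof. by rewrite expr_3q0 !fE [(x ^+ q) ^+ q0]exprAC; ring3. Qed.
Let Y3q : (Y ^+ q) ^+ 3 = Y ^+ 3 + x ^+ q * E.
Proof.
have -> : Y ^+ q = (y ^+ q) ^+ q0 by rewrite exprAC.
by rewrite yq expr_3q0 !fE.
Qed.
Let Z3q : (Z ^+ q) ^+ 3 = Z ^+ 3 + (x ^+ q) ^+ 2 * E.
Proof.
have -> : Z ^+ q = (z ^+ q) ^+ q0 by rewrite exprAC.
by rewrite zq expr_3q0 !fE.
Qed.

Let fq := (frobD pnat_q, frobN pnat_q, @frobM F q, @frob2 F q, @frob3 F q,
  frobD pnat3, frobN pnat3, @frobM F 3, @frob2 F 3).

(* Each coordinate v0 of the point in P^6 starts such a chain of coordinates of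
   vectors v1, .., v5. The vectors v0, .., v3 are orthogonal to the point, so
   only the coefficients of v4 and v5 matter for [ree_form]. *)
Section Chain.
Variables (D E v0 v1 v2 v3 v4 v5 : F).
Local Notation D1 := (D ^+ q).
Local Notation D2 := (D1 ^+ q).
Local Notation D3 := (D2 ^+ q).
Local Notation E1 := (E ^+ q).
Local Notation E2 := (E1 ^+ q).
Hypothesis h0 : v0 ^+ q = v0 + D * v1.
Hypothesis h1 : v1 ^+ q = v1 + E * v2.
Hypothesis h2 : v2 ^+ q = v2 + D1 * v3 + D1 ^+ 2 * v4.
Hypothesis h3 : v3 ^+ q = v3 - D1 * v4.
Hypothesis h4 : v4 ^+ q = v4 + E1 * v5.

Let chain2 : v0 ^+ (q ^ 2) = v0 + (D1 + D) * v1 + D1 * E * v2.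
Proof. rewrite -mulnn exprM h0 !fq h0 h1; move: D1 => *; ring3. Qed.

Lemma ree_chain3 : v0 ^+ (q ^ 3) =
  v0 + (D2 + D1 + D) * v1 + (D2 * E1 + (D2 + D1) * E) * v2
  + D1 * E1 * D2 * v3 + D1 ^+ 2 * E1 * D2 * v4.
Proof.
rewrite expnSr exprM chain2 !fq h0 h1 h2; move: E1 D2 D1 => *; ring3.
Qed.

Lemma ree_chain4 : v0 ^+ (q ^ 4) =
  v0 + (D3 + D2 + D1 + D) * v1 + (D3 * E2 + (D3 + D2) * E1 + (D3 + D2 + D1) * E) * v2
  + (D2 * E2 * D3 + D1 * (D3 * E2 + (D3 + D2) * E1)) * v3
  + (D2 ^+ 2 * E2 * D3 - D1 * D2 * E2 * D3 + D1 ^+ 2 * (E2 * D3 + E1 * D3 + E1 * D2)) * v4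
  + D2 ^+ 2 * E2 * D3 * E1 * v5.
Proof.
rewrite expnSr exprM ree_chain3 !fq h0 h1 h2 h3 h4.
move: E2 D3 E1 D2 D1 => *; ring3.
Qed.
End Chain.

Local Notation T := (x ^+ q).
Local Notation D1 := (D ^+ q).
Local Notation E1 := (E ^+ q).

(** The vector v2 is (0, 0, 1, T, T^2, [v2_6], [v2_8]); its last two entries are read off from the
    q-th powers of the last two entries of v1. *)
Let v2_6 := - (T * Y ^+ 3) - Z ^+ 3 - T ^+ 2 * X ^+ 3.
Let v2_8 := (w1 ^+ q0) ^+ 3 + T ^+ 2 * Y ^+ 3 + T * Z ^+ 3.

Let h0_1 : w1 ^+ q = w1 + D * X ^+ 3.
Proof. rewrite -expr_q0_q0_3 ree_w1_q0 !fE xq ree_w1E; move: D => *; ring3. Qed.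
Let h0_2 : w2 ^+ q = w2 + D * Y ^+ 3.
Proof. rewrite -expr_q0_q0_3 ree_w2_q0 !fE xq ree_w2E; move: D => *; ring3. Qed.
Let h0_3 : w3 ^+ q = w3 + D * Z ^+ 3.
Proof.
rewrite -expr_q0_q0_3 ree_w3_q0 (frobD q0n) (frobN q0n) ree_w1_q0 !fE ree_w3E xq.
move: D => *; ring3.
Qed.
Let h1_6 : ((w4 ^+ q0) ^+ 3) ^+ q = (w4 ^+ q0) ^+ 3 + E * v2_6.
Proof.
rewrite /v2_6 ree_w4_q0 !fq X3q Y3q Z3q; move: T E => *; ring3.
Qed.
Let h1_8 : ((w7 ^+ q0) ^+ 3) ^+ q = (w7 ^+ q0) ^+ 3 + E * v2_8.
Proof.
rewrite /v2_8 ree_w7_q0 ree_w1_q0 !fq X3q Y3q Z3q yq zq xq.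
move: E D X Y Z => *; ring3.
Qed.

Let h2_6 : v2_6 ^+ q = v2_6 + D1 * (T * X ^+ 3 - Y ^+ 3)
  + D1 ^+ 2 * (- (X ^+ 3 + E)).
Proof. rewrite /v2_6 !fq X3q Y3q Z3q tq; move: T D1 E => *; ring3. Qed.
Let h2_8 : v2_8 ^+ q = v2_8 + D1 * (Z ^+ 3 - T * Y ^+ 3)
  + D1 ^+ 2 * (Y ^+ 3 + T * E).
Proof.
rewrite /v2_8 ree_w1_q0 !fq X3q Y3q Z3q tq yq.
move: D1 E => *; move: T X Y Z => *; ring3.
Qed.
Let h3_6 : (T * X ^+ 3 - Y ^+ 3) ^+ q = T * X ^+ 3 - Y ^+ 3 - D1 * (- (X ^+ 3 + E)).
Proof. rewrite !fq X3q Y3q tq; move: T D1 E => *; ring3. Qed.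
Let h3_8 : (Z ^+ 3 - T * Y ^+ 3) ^+ q = Z ^+ 3 - T * Y ^+ 3 - D1 * (Y ^+ 3 + T * E).
Proof. rewrite !fq Y3q Z3q tq; move: T D1 E => *; ring3. Qed.
Let h4_6 : (- (X ^+ 3 + E)) ^+ q = - (X ^+ 3 + E) + E1 * -1.
Proof. rewrite (frobN pnat_q) (frobD pnat_q) frob3 X3q; move: E E1 => *; ring3. Qed.
Let h4_8 : (Y ^+ 3 + T * E) ^+ q = Y ^+ 3 + T * E + E1 * (T + D1).
Proof.
rewrite (frobD pnat_q) frobM frob3 Y3q tq; move: T D1 E E1 => *; ring3.
Qed.

Let q_gt0 : (0 < q)%N.
Proof. by case/andP: pnat_q. Qed.
Let zq0 : (0 : F) ^+ q = 0.
Proof. by rewrite expr0n eqn0Ngt q_gt0. Qed.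

(** The polar form against P, linear in the other argument. It is evaluated below at P = v0 and at
    v1, ..., v5; v0 gives 0 by the quadric, because 2 = -1. *)
Let pairing (a0 a1 a2 a3 a4 a5 a6 : F) : F :=
  a6 + x * a5 + w1 * a4 + w2 * a3 + w3 * a2 + w6 * a1 + w8 * a0.
Let pairing0 : pairing 1 x w1 w2 w3 w6 w8 = 0.
Proof.
transitivity (w2 * w2 - (w8 + x * w6 + w1 * w3)); first by rewrite /pairing; ring3.
by rewrite ree_quadric subrr.
Qed.
Let pairing1 :
  pairing 0 1 (X ^+ 3) (Y ^+ 3) (Z ^+ 3) ((w4 ^+ q0) ^+ 3) ((w7 ^+ q0) ^+ 3) = 0.
Proof. rewrite /pairing; ree_ring. Qed.
Let pairing2 : pairing 0 0 1 T (T ^+ 2) v2_6 v2_8 = 0.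
Proof. rewrite /pairing /v2_6 /v2_8; ree_ring. Qed.
Let pairing3 : pairing 0 0 0 1 (- T) (T * X ^+ 3 - Y ^+ 3) (Z ^+ 3 - T * Y ^+ 3) = 0.
Proof. rewrite /pairing; ree_ring. Qed.
Let pairing4 : pairing 0 0 0 0 1 (- (X ^+ 3 + E)) (Y ^+ 3 + T * E) = D * E.
Proof. rewrite /pairing ree_w1E; move: E => *; ree_ring. Qed.
Let pairing5 : pairing 0 0 0 0 0 (-1) (T + D1) = D + D1.
Proof. rewrite /pairing; move: D1 => *; ring3. Qed.

Local Notation D2 := (D1 ^+ q).
Local Notation D3 := (D2 ^+ q).
Local Notation E2 := (E1 ^+ q).

Let h0_x : x ^+ q = x + D * 1. Proof. by rewrite mulr1 -xq. Qed.
Let h1_x (u : F) : 1 ^+ q = 1 + u * 0. Proof. by rewrite expr1n mulr0 addr0. Qed.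
Let h0_0 (u : F) : 0 ^+ q = 0 + u * 0. Proof. by rewrite zq0 mulr0 addr0. Qed.
Let h2_0 (u : F) : 0 ^+ q = 0 + u * 0 + u ^+ 2 * 0.
Proof. by rewrite zq0 !mulr0 !addr0. Qed.
Let h3_0 (u : F) : 0 ^+ q = 0 - u * 0. Proof. by rewrite zq0 mulr0 subr0. Qed.
Let h1_1 : (X ^+ 3) ^+ q = X ^+ 3 + E * 1.
Proof. by rewrite frob3 X3q mulr1. Qed.
Let h1_2 : (Y ^+ 3) ^+ q = Y ^+ 3 + E * T.
Proof. by rewrite frob3 Y3q mulrC. Qed.
Let h1_3 : (Z ^+ 3) ^+ q = Z ^+ 3 + E * T ^+ 2.
Proof. by rewrite frob3 Z3q mulrC. Qed.
Let h2_1 : 1 ^+ q = 1 + D1 * 0 + D1 ^+ 2 * 0.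
Proof. by rewrite expr1n !mulr0 !addr0. Qed.
Let h2_2 : T ^+ q = T + D1 * 1 + D1 ^+ 2 * 0.
Proof. by rewrite tq mulr1 mulr0 addr0. Qed.
Let h2_3 : (T ^+ 2) ^+ q = T ^+ 2 + D1 * (- T) + D1 ^+ 2 * 1.
Proof. rewrite frob2 tq; move: T D1 => *; ring3. Qed.
Let h3_2 : 1 ^+ q = 1 - D1 * 0.
Proof. by rewrite expr1n mulr0 subr0. Qed.
Let h3_3 : (- T) ^+ q = - T - D1 * 1.
Proof. by rewrite (frobN pnat_q) tq opprD mulr1. Qed.

Lemma ree_form_q3 : ree_form (q ^ 3) = D * E * D1 ^+ 2 * E1 * D2.
Proof.
rewrite /ree_form (ree_chain3 h0_x (h1_x E) (h2_0 D1)).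
rewrite (ree_chain3 h0_1 h1_1 h2_1) (ree_chain3 h0_2 h1_2 h2_2).
rewrite (ree_chain3 h0_3 h1_3 h2_3) (ree_chain3 ree_w6_q h1_6 h2_6).
rewrite (ree_chain3 ree_w8_q h1_8 h2_8).
set u1 := D2 + D1 + D; set u2 := D2 * E1 + _; set u3 := D1 * E1 * D2.
set u4 := D1 ^+ 2 * E1 * D2.
transitivity (pairing 1 x w1 w2 w3 w6 w8
  + u1 * pairing 0 1 (X ^+ 3) (Y ^+ 3) (Z ^+ 3) ((w4 ^+ q0) ^+ 3) ((w7 ^+ q0) ^+ 3)
  + u2 * pairing 0 0 1 T (T ^+ 2) v2_6 v2_8
  + u3 * pairing 0 0 0 1 (- T) (T * X ^+ 3 - Y ^+ 3) (Z ^+ 3 - T * Y ^+ 3)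
  + u4 * pairing 0 0 0 0 1 (- (X ^+ 3 + E)) (Y ^+ 3 + T * E)).
  rewrite /pairing; move: u1 u2 u3 u4 v2_6 v2_8 E => u1 u2 u3 u4 a6 a8 e.
  ring3.
rewrite pairing0 pairing1 pairing2 pairing3 pairing4 /u4.
move: D1 D2 E E1 D => *; ring3.
Qed.

Lemma ree_form_q4 : ree_form (q ^ 4) =
  D * E * (D2 ^+ 2 * E2 * D3 - D1 * D2 * E2 * D3
           + D1 ^+ 2 * (E2 * D3 + E1 * D3 + E1 * D2))
  + (D + D1) * (D2 ^+ 2 * E2 * D3 * E1).
Proof.
rewrite /ree_form (ree_chain4 h0_x (h1_x E) (h2_0 D1) (h3_0 D1) (h0_0 E1)).
rewrite (ree_chain4 h0_1 h1_1 h2_1 (h3_0 D1) (h0_0 E1)).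
rewrite (ree_chain4 h0_2 h1_2 h2_2 h3_2 (h0_0 E1)).
rewrite (ree_chain4 h0_3 h1_3 h2_3 h3_3 (h1_x E1)).
rewrite (ree_chain4 ree_w6_q h1_6 h2_6 h3_6 h4_6).
rewrite (ree_chain4 ree_w8_q h1_8 h2_8 h3_8 h4_8).
set u1 := D3 + D2 + D1 + D; set u2 := D3 * E2 + (_ + _) * E1 + _.
set u3 := D2 * E2 * D3 + _; set u4 := D2 ^+ 2 * E2 * D3 - _ + _.
set u5 := D2 ^+ 2 * E2 * D3 * E1.
transitivity (pairing 1 x w1 w2 w3 w6 w8
  + u1 * pairing 0 1 (X ^+ 3) (Y ^+ 3) (Z ^+ 3) ((w4 ^+ q0) ^+ 3) ((w7 ^+ q0) ^+ 3)
  + u2 * pairing 0 0 1 T (T ^+ 2) v2_6 v2_8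
  + u3 * pairing 0 0 0 1 (- T) (T * X ^+ 3 - Y ^+ 3) (Z ^+ 3 - T * Y ^+ 3)
  + u4 * pairing 0 0 0 0 1 (- (X ^+ 3 + E)) (Y ^+ 3 + T * E)
  + u5 * pairing 0 0 0 0 0 (-1) (T + D1)).
  rewrite /pairing; move: u1 u2 u3 u4 u5 v2_6 v2_8 E D1 => u1 u2 u3 u4 u5 a6 a8 e d.
  ring3.
rewrite pairing0 pairing1 pairing2 pairing3 pairing4 pairing5.
move: u4 u5 D1 E D => *; ring3.
Qed.
End Curve.

Section FormRatio.
Variables (F : fieldType) (q0 q : nat) (x y z : F).
Hypothesis ch : 3%N \in [pchar F].
Hypothesis q0n : [pchar F].-nat q0.
Hypothesis hq : q = (3 * q0 ^ 2)%N.
Hypothesis hP : ree_point q0 q x y z.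

Local Notation D := (x ^+ q - x).

Local Notation theta := (ree_theta q x).

(** This is the origin of B_R: with D^q = theta * D, the seven monomials of the form at q^4, divided
    by the single monomial of the form at q^3, become the seven terms of B_R(theta). *)
Lemma ree_form_q4_B : ree_form q0 x y z (q ^ 4) =
  ree_form q0 x y z (q ^ 3) * (ree_B F q0 q).[theta].
Proof.
rewrite (ree_form_q4 ch q0n hq hP) (ree_form_q3 ch q0n hq hP) /ree_B.
rewrite !(hornerD, hornerN, hornerXn) -polyC1 hornerC.
have q1 : (q - 1).+1 = q.
  by rewrite subn1 prednK //; case/andP: (pnat_q ch q0n hq).
have e1 : D ^+ q = theta * D by rewrite /ree_theta -exprSr q1.
move: (3 * q0)%N => r; rewrite mul2n -addnn -mulnn !addnA.
rewrite ![(D ^+ r) ^+ q]exprAC; move: theta D e1 => a d e1.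
rewrite ![a ^+ (_ + _)]exprD !expr1 !exprM !(e1, exprMn).
rewrite ![(d ^+ r) ^+ q]exprAC !(e1, exprMn).
move: (a ^+ q) (a ^+ q ^+ q) (a ^+ r) (a ^+ r ^+ q) (d ^+ r) => b b2 e e2 dr.
by ring.
Qed.
End FormRatio.

(** * The image point of the involution and the invariance of t_R *)

Section Involution.
Variables (F : fieldType) (q0 q : nat) (x y z : F).
Hypothesis ch : 3%N \in [pchar F].
Hypothesis q0n : [pchar F].-nat q0.
Hypothesis hq : q = (3 * q0 ^ 2)%N.
Hypothesis hP : ree_point q0 q x y z.

Local Notation w1 := (ree_w1 q0 x y).
Local Notation w2 := (ree_w2 q0 x y z).
Local Notation w3 := (ree_w3 q0 x y z).
Local Notation w4 := (ree_w4 q0 x y z).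
Local Notation v := (ree_v q0 x y z).
Local Notation w5 := (ree_w5 q0 x y z).
Local Notation w6 := (ree_w6 q0 x y z).
Local Notation w7 := (ree_w7 q0 x y z).
Local Notation w8 := (ree_w8 q0 x y z).
Local Notation w9 := (ree_w9 q0 x y z).
Local Notation w10 := (ree_w10 q0 x y z).
Local Notation D := (x ^+ q - x).

Local Notation theta := (ree_theta q x).

Hypothesis w8n0 : w8 != 0.
Local Notation x' := (w6 / w8).
Local Notation y' := (w10 / w8).
Local Notation z' := (w9 / w8).

Let k8n0 : w8 ^+ q0 != 0. Proof. exact: expf_neq0. Qed.

Let div3 (a b c u k : F) : k != 0 -> a * b ^+ 3 - w8 * u ^+ 3 = c * k ^+ 3 ->
  a / w8 * (b / k) ^+ 3 - (u / k) ^+ 3 = c / w8.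
Proof.
move=> kn0 e; transitivity ((a * b ^+ 3 - w8 * u ^+ 3) / (w8 * k ^+ 3)).
  by field; rewrite w8n0 kn0.
by rewrite e; field; rewrite w8n0 kn0.
Qed.

Let div2 (a b c d e : F) : a * b - c * d = e * w8 ->
  a / w8 * (b / w8) - c / w8 * (d / w8) = e / w8.
Proof.
move=> eq1; transitivity ((a * b - c * d) / (w8 * w8)); first by field.
by rewrite eq1; field.
Qed.

Let w1' : ree_w1 q0 x' y' = w3 / w8.
Proof.
rewrite [LHS]/ree_w1 addn1 exprS !expr_3q0 ![(_ / _) ^+ q0]expr_div_n.
by apply: div3 => //; exact: ree_cubic1 hP.
Qed.

Let w2' : ree_w2 q0 x' y' z' = - w2 / w8.
Proof.
rewrite [LHS]/ree_w2 !expr_3q0 ![(_ / _) ^+ q0]expr_div_n.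
by apply: div3 => //; exact: ree_cubic2 hP.
Qed.

(** The curve equations are equivalent to X x^q - y^q = x X - y and X y^q - z^q = X y - z, whose
    left sides are w1^q0 and w2^q0. As w1 and w2 at the image are w3 / w8 and - w2 / w8, the
    equations there reduce to [ree_quadratic_y] and [ree_quadratic_z]. *)
Lemma ree_involution_point : ree_point q0 q x' y' z'.
Proof.
have q_q0 (u : F) : ((u ^+ q0) ^+ 3) ^+ q0 = u ^+ q.
  by rewrite exprAC (expr_q0_q0_3 hq).
have fw1 (a b : F) : ree_w1 q0 a b ^+ q0 = a ^+ q0 * a ^+ q - b ^+ q.
  rewrite /ree_w1 addn1 exprS !expr_3q0 (frobD q0n) (frobN q0n) frobM.
  by rewrite !q_q0.
have fw2 (a b c : F) : ree_w2 q0 a b c ^+ q0 = a ^+ q0 * b ^+ q - c ^+ q.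
  by rewrite /ree_w2 !expr_3q0 (frobD q0n) (frobN q0n) frobM !q_q0.
have ey : x' ^+ q0 * x' ^+ q - y' ^+ q = x' * x' ^+ q0 - y'.
  have := ree_quadratic_y ch q0n hq hP; rewrite -fw1 w1' !expr_div_n => e.
  transitivity ((w6 * w6 ^+ q0 - w10 * w8 ^+ q0) / (w8 * w8 ^+ q0)).
    by rewrite e; field; rewrite ?k8n0 ?w8n0.
  by field; rewrite ?k8n0 ?w8n0.
have ez : x' ^+ q0 * y' ^+ q - z' ^+ q = x' ^+ q0 * y' - z'.
  have := ree_quadratic_z ch q0n hq hP.
  rewrite -fw2 w2' !expr_div_n (frobN q0n) => e.
  transitivity ((w6 ^+ q0 * w10 - w8 ^+ q0 * w9) / (w8 * w8 ^+ q0)).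
    by rewrite e; field; rewrite ?k8n0 ?w8n0.
  by field; rewrite ?k8n0 ?w8n0.
move: (x') (y') (z') ey ez => a b c ey ez.
have e1 : b ^+ q = a ^+ q0 * a ^+ q - (a * a ^+ q0 - b) by rewrite -ey; ring.
have e2 : c ^+ q = a ^+ q0 * b ^+ q - (a ^+ q0 * b - c) by rewrite -ez; ring.
split; first by rewrite e1; ring.
by rewrite e2 e1 [(2 * q0)%N]mulnC exprM; ring.
Qed.

Let hP' := ree_involution_point.

Let w3' : ree_w3 q0 x' y' z' = w1 / w8.
Proof.
rewrite /ree_w3 w1' !expr_3q0 ![(_ / _) ^+ q0]expr_div_n; apply: div3 => //.
exact: ree_cubic3 hP.
Qed.

Let w4' : ree_w4 q0 x' y' z' = w5 / w8.
Proof.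
rewrite (ree_w4E ch q0n hq hP'); apply: div2; exact: ree_quadratic4 hP.
Qed.

Let v' : ree_v q0 x' y' z' = - v / w8.
Proof.
rewrite (ree_vE ch q0n hq hP') w1'; apply: div2; exact: ree_quadratic_v hP.
Qed.

Let w5' : ree_w5 q0 x' y' z' = w4 / w8.
Proof.
rewrite (ree_w5E ch q0n hq hP') w1'; apply: div2; exact: ree_quadratic5 hP.
Qed.

Let w6' : ree_w6 q0 x' y' z' = x / w8.
Proof.
rewrite (ree_w6E _ _ _ _ ch) v' w2' w4' !mulNr !(frobN q0n).
rewrite ![(_ / _) ^+ q0]expr_div_n -opprD -mulrBl (frobN (pnat3 ch)) addrC.
apply: div3 => //; exact: ree_cubic6 hP.
Qed.

Let w8' : ree_w8 q0 x' y' z' = 1 / w8.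
Proof.
rewrite ree_w8E /ree_w7 v' w2' w5' -mulrDl -opprD mulNr (frobN q0n).
rewrite ![(_ / _) ^+ q0]expr_div_n (frobN (pnat3 ch)).
transitivity ((w8 * (w4 ^+ q0) ^+ 3 - w6 * (w7 ^+ q0) ^+ 3) / (w8 * (w8 ^+ q0) ^+ 3)).
  by rewrite /ree_w7; field; rewrite ?k8n0 ?w8n0.
by rewrite (ree_cubic8 ch q0n hq hP); field; rewrite ?k8n0 ?w8n0.
Qed.

Lemma ree_form_involution n : [pchar F].-nat n ->
  ree_form q0 x' y' z' n = ree_form q0 x y z n / (w8 * w8 ^+ n).
Proof.
move=> hn; rewrite /ree_form w1' w2' w3' w6' w8' !mulNr (frobN hn) !expr_div_n.
by rewrite expr1n; field; rewrite expf_neq0.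
Qed.

(** The numerator w6^q w8 - w6 w8^q equals D times w8 w4^(3 q0) - w6 w7^(3 q0) by the formulas for
    w6^q and w8^q, and the second factor is w8^(3 q0) by [ree_cubic8]. *)
Lemma ree_D_involution :
  (x' ^+ q - x') * w8 ^+ (q + 1) = D * w8 ^+ (3 * q0).
Proof.
rewrite expr_3q0 -(ree_cubic8 ch q0n hq hP) expr_div_n (ree_w6_q ch q0n hq hP).
rewrite addn1 [w8 ^+ _.+1]exprS.
transitivity ((w6 + D * (w4 ^+ q0) ^+ 3) * w8 - w6 * w8 ^+ q).
  by field; rewrite w8n0 expf_neq0.
by rewrite (ree_w8_q ch q0n hq hP); ring.
Qed.

Hypothesis q0_gt0 : (0 < q0)%N.

Let jE : (q - 3 * q0 + 1 + 3 * q0 = q + 1)%N.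
Proof.
by rewrite addnAC subnK // hq -mulnn leq_mul2l leq_pmulr ?orbT.
Qed.

Lemma ree_D_involution_div : x' ^+ q - x' = D / w8 ^+ (q - 3 * q0 + 1).
Proof.
apply: (mulIf (expf_neq0 (q + 1) w8n0)); rewrite ree_D_involution -jE.
by rewrite [w8 ^+ (_ + 3 * q0)]exprD mulrA divfK ?expf_neq0.
Qed.

Lemma ree_theta_involution :
  ree_theta q x' = theta / w8 ^+ ((q - 3 * q0 + 1) * (q - 1)).
Proof. by rewrite /ree_theta ree_D_involution_div expr_div_n -exprM. Qed.

Hypothesis Dn0 : D != 0.

Let form3_neq0 : ree_form q0 x y z (q ^ 3) != 0.
Proof. by rewrite (ree_form_q3 ch q0n hq hP) !mulf_neq0 ?expf_neq0. Qed.

Lemma ree_t_involution : ree_t q0 q x' = ree_t q0 q x.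
Proof.
have qn := pnat_q ch q0n hq; have q_gt0 : (0 < q)%N by case/andP: qn.
(* B_R at the image is the quotient of the two forms there; the division is legitimate because the
   form at q^3 is a monomial in D, up to a factor in w8. *)
have B' : (ree_B F q0 q).[ree_theta q x'] =
    (ree_B F q0 q).[theta] * w8 ^+ (q ^ 3) / w8 ^+ (q ^ 4).
  have f3' := ree_form_involution (n := (q ^ 3)%N) ltac:(by rewrite pnatX qn).
  have f4' := ree_form_involution (n := (q ^ 4)%N) ltac:(by rewrite pnatX qn).
  have nz : ree_form q0 x' y' z' (q ^ 3) != 0.
    by rewrite f3' mulf_neq0 // invr_neq0 // mulf_neq0 // expf_neq0.
  apply: (mulfI nz); rewrite -(ree_form_q4_B ch q0n hq hP') f3' f4'.
  rewrite (ree_form_q4_B ch q0n hq hP); field.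
  by rewrite w8n0 !expf_neq0.
rewrite /ree_t B' ree_theta_involution !expr_div_n exprMn -!exprM.
have -> : (q ^ 4 * (q - 3 * q0 + 1) =
    q ^ 3 * (q - 3 * q0 + 1) + (q - 3 * q0 + 1) * (q - 1) * q ^ 3)%N.
  rewrite expnS subn1 -{1}(prednK q_gt0).
  by move: (q ^ 3)%N (q - 3 * q0 + 1)%N q.-1 => c j p; ring.
have thn0 : theta != 0 by rewrite expf_neq0.
have cancel (a u d c : F) : u != 0 -> d != 0 -> c != 0 ->
    a * u / (u * d) / (c / d) = a / c.
  by move=> un0 dn0 cn0; field; rewrite un0 dn0 cn0.
by rewrite [w8 ^+ (q ^ 3 * _ + _)]exprD; apply: cancel; rewrite expf_neq0.
Qed.
End Involution.

(** * Subfields and descent *)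

Section AdjoinField.
Variables (K F : fieldType) (iota : {rmorphism K -> F}) (gs : seq F).

(** The classical truth value makes K(gs) a boolean predicate, hence a field type [adjoin_field]
    over which polynomials and division are available. *)
Definition adjoined : {pred F} := fun u => `[< adjoin iota gs u >].

Lemma adjoinedP u : reflect (adjoin iota gs u) (u \in adjoined).
Proof. exact: asboolP. Qed.

Lemma adjoined_divring_closed : divring_closed adjoined.
Proof.
split=> [|u v /adjoinedP hu /adjoinedP hv|u v /adjoinedP hu /adjoinedP hv].
- by apply/adjoinedP; rewrite -(rmorph1 iota); apply: adjoin_const.
- by apply/adjoinedP; apply: adjoinD => //; apply: adjoinN.
- by apply/adjoinedP; apply: adjoinM => //; apply: adjoinV.
Qed.
HB.instance Definition _ :=
  GRing.isDivringClosed.Build F adjoined adjoined_divring_closed.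

Record adjoin_field := AdjoinField {
  adjoin_val :> F;
  adjoin_valP : adjoin_val \in adjoined
}.
HB.instance Definition _ := [isSub for adjoin_val].
HB.instance Definition _ := [Choice of adjoin_field by <:].
HB.instance Definition _ := [SubChoice_isSubIntegralDomain of adjoin_field by <:].
HB.instance Definition _ := [SubIntegralDomain_isSubField of adjoin_field by <:].

Definition adjoin_emb : {rmorphism adjoin_field -> F} := (val : adjoin_field -> F).

Lemma adjoin_embP u : adjoin iota gs u <-> exists l, u = adjoin_emb l.
Proof.
split=> [/adjoinedP hu|[l ->]]; last exact/adjoinedP/(valP l).
by exists (AdjoinField hu).
Qed.

Definition adjoin_cst (k : K) : adjoin_field :=
  AdjoinField (introT (adjoinedP _) (adjoin_const iota gs k)).

Lemma adjoin_cst_zmod : zmod_morphism adjoin_cst.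
Proof. by move=> a b; apply: val_inj; rewrite /= rmorphB. Qed.
Lemma adjoin_cst_monoid : monoid_morphism adjoin_cst.
Proof.
by split=> [|a b]; apply: val_inj; rewrite /= ?rmorph1 ?rmorphM.
Qed.
HB.instance Definition _ :=
  GRing.isZmodMorphism.Build K adjoin_field adjoin_cst adjoin_cst_zmod.
HB.instance Definition _ :=
  GRing.isMonoidMorphism.Build K adjoin_field adjoin_cst adjoin_cst_monoid.

End AdjoinField.

Lemma adjoin_fixed (K F : fieldType) (iota : {rmorphism K -> F}) (gs : seq F)
    (sigma : {rmorphism F -> F}) :
  (forall k, sigma (iota k) = iota k) -> {in gs, forall g, sigma g = g} ->
  forall u, adjoin iota gs u -> sigma u = u.
Proof.
move=> hK hgs u; elim=> {u} [k|g|a b _ ea _ eb|a _ ea|a b _ ea _ eb|a _ ea].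
- exact: hK.
- exact: hgs.
- by rewrite rmorphD ea eb.
- by rewrite rmorphN ea.
- by rewrite rmorphM ea eb.
- by rewrite fmorphV ea.
Qed.

Lemma algebraic_over_closed (K : closedFieldType) (F : fieldType)
    (iota : {rmorphism K -> F}) u :
  algebraicOver iota u -> exists k, u = iota k.
Proof.
case=> p pn0; have [rs ->] := closed_field_poly_normal p.
rewrite linearZ /= rootZ ?fmorph_eq0 ?lead_coef_eq0 //.
rewrite map_prod_XsubC -(big_map iota xpredT (fun c => 'X - c%:P)).
rewrite root_prod_XsubC => /mapP[k _ ->].
by exists k.
Qed.

(** * Simple algebraic extensions *)

Section SimpleExtension.
Variables (L F : fieldType) (j : {rmorphism L -> F}) (w : F).

Lemma minimal_poly_ex (P : {poly L}) : P != 0 -> root (map_poly j P) w ->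
  exists2 m : {poly L}, m \is monic & [/\ root (map_poly j m) w, (size m <= size P)%N &
    forall Q : {poly L}, root (map_poly j Q) w -> (size Q < size m)%N -> Q = 0].
Proof.
elim: {P}(size P) {-2}P (leqnn (size P)) => [|n IH] P.
  by rewrite leqn0 size_poly_eq0 => /eqP-> /eqP.
move=> szP Pn0 rP.
have [[Q [rQ szQ Qn0]]|noQ] := pselect (exists Q : {poly L},
    [/\ root (map_poly j Q) w, (size Q < size P)%N & Q != 0]).
  have szQn : (size Q <= n)%N by rewrite -ltnS (leq_trans szQ).
  have [m mm [rm szm min]] := IH Q szQn Qn0 rQ.
  by exists m => //; split=> //; rewrite (leq_trans szm) // ltnW.
exists ((lead_coef P)^-1 *: P).
  by rewrite monicE lead_coefZ mulVf ?lead_coef_eq0.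
have an0 : (lead_coef P)^-1 != 0 by rewrite invr_eq0 lead_coef_eq0.
rewrite size_scale //; split=> //; first by rewrite linearZ /= rootZ ?fmorph_eq0.
move=> Q rQ szQ; apply/eqP/negPn/negP=> Qn0; apply: noQ; by exists Q.
Qed.

Definition poly_value (u : F) := exists R : {poly L}, u = (map_poly j R).[w].

Lemma poly_valueD u v : poly_value u -> poly_value v -> poly_value (u + v).
Proof. by move=> [R ->] [S ->]; exists (R + S); rewrite rmorphD hornerD. Qed.
Lemma poly_valueN u : poly_value u -> poly_value (- u).
Proof. by move=> [R ->]; exists (- R); rewrite rmorphN hornerN. Qed.
Lemma poly_valueM u v : poly_value u -> poly_value v -> poly_value (u * v).
Proof. by move=> [R ->] [S ->]; exists (R * S); rewrite rmorphM hornerM. Qed.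
Lemma poly_value_const l : poly_value (j l).
Proof. by exists l%:P; rewrite map_polyC hornerC. Qed.
Lemma poly_value_gen : poly_value w.
Proof. by exists 'X; rewrite map_polyX hornerX. Qed.

(** If R(w) is not 0, the cofactor in the minimal polynomial m of gcd(R, m) still kills w, so by
    minimality the gcd is constant; a Bezout relation evaluated at w inverts R(w). *)
Lemma poly_valueV u : algebraicOver j w -> poly_value u -> poly_value u^-1.
Proof.
move=> [P Pn0 rP] [R ->]; have [->|vn0] := eqVneq (map_poly j R).[w] 0.
  by rewrite invr0; exists 0; rewrite rmorph0 horner0.
have [m mm [rm _ min]] := minimal_poly_ex Pn0 rP.
have cop : coprimep R m.
  have mn0 := monic_neq0 mm; set g := gcdp R m.
  have gn0 : g != 0 by rewrite gcdp_eq0 negb_and mn0 orbT.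
  have em : m = m %/ g * g by rewrite divpK // dvdp_gcdr.
  have hn0 : m %/ g != 0 by apply: contraNneq mn0 => h0; rewrite em h0 mul0r.
  have : root (map_poly j (m %/ g)) w.
    move: rm; rewrite {1}em rmorphM rootM => /orP[//|rg].
    case/negP: vn0; have /dvdpP[c ->] := dvdp_gcdl R m.
    by rewrite rmorphM hornerM (rootP rg) mulr0.
  move=> rh; have szm : (size m <= size (m %/ g)%R)%N.
    by rewrite leqNgt; apply/negP=> /(min _ rh)/eqP; rewrite (negbTE hn0).
  rewrite /coprimep -/g; move: szm; rewrite {1}em size_mul //.
  case: (size g) (size_poly_gt0 g); first by rewrite gn0.
  by move=> k _; rewrite addnS /= -{2}[size _]addn0 leq_add2l leqn0 eqSS.
have /Bezout_coprimepP[[a b] /eqpP[[c1 c2] /= /andP[c1n0 c2n0] e]] := cop.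
have := congr1 (fun p => (map_poly j p).[w]) e.
rewrite !linearZ /= rmorphD !rmorphM rmorph1 !hornerE (rootP rm) mulr0 addr0.
move=> e1; exists ((c1 / c2) *: a); rewrite linearZ /= hornerZ.
apply: (mulIf vn0); rewrite mulVf // -mulrA.
rewrite -[LHS](mulfK (_ : j c2 != 0)) ?fmorph_eq0 // mul1r fmorph_div.
by rewrite -[j c2]mulr1 -e1 mulr1 mulrAC.
Qed.

Lemma adjoin_poly_value (K : fieldType) (iota : {rmorphism K -> F}) gs u :
  algebraicOver j w -> (forall k, exists l, iota k = j l) ->
  {in gs, forall g, poly_value g} -> adjoin iota gs u -> poly_value u.
Proof.
move=> algw hK hgs; elim=> {u} [k|g|a b _ pa _ pb|a _ pa|a b _ pa _ pb|a _ pa].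
- by have [l ->] := hK k; apply: poly_value_const.
- exact: hgs.
- exact: poly_valueD.
- exact: poly_valueN.
- exact: poly_valueM.
- exact: poly_valueV.
Qed.

(* Reduce u, a polynomial in w, modulo P: the remainder takes the value u at
   more points than its degree, hence is constant. *)
Lemma fixed_poly_value (P : {poly L}) (ws : seq F) u :
  P != 0 -> root (map_poly j P) w -> poly_value u ->
  uniq ws -> (size P <= (size ws).+1)%N ->
  {in ws, forall w', exists sigma : {rmorphism F -> F},
    [/\ sigma w = w', sigma u = u & forall l, sigma (j l) = j l]} ->
  exists l, u = j l.
Proof.
move=> Pn0 rP [R eu] uws szP hws.
pose S := R %% P; have szS : (size S <= size ws)%N.
  by rewrite -ltnS (leq_trans _ szP) // ltn_modp.
have eS : u = (map_poly j S).[w].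
  rewrite eu {1}(divp_eq R P) rmorphD rmorphM hornerD hornerM (rootP rP).
  by rewrite mulr0 add0r.
have fS w' : w' \in ws -> (map_poly j S).[w'] = u.
  move=> /hws[sigma [<- su hL]]; rewrite -[RHS]su eS -horner_map.
  by rewrite -map_poly_comp (eq_map_poly hL).
(* A nonzero constant has no root, so P has positive degree and [ws] is nonempty; this makes the
   constant polynomial u obey the same size bound as S. *)
have szP2 : (1 < size P)%N.
  rewrite ltnNge; apply/negP=> szP1; have := rP; rewrite (size1_polyC szP1).
  rewrite map_polyC rootC fmorph_eq0; apply/negP; apply: contraNneq Pn0 => P0.
  by rewrite (size1_polyC szP1) P0.
have ws_gt0 : (0 < size ws)%N by rewrite -ltnS (leq_trans szP2).
have S0 : map_poly j S - u%:P = 0.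
  apply/eqP/negPn/negP=> nz.
  have rws : all (root (map_poly j S - u%:P)) ws.
    by apply/allP=> w' /fS e; rewrite rootE !hornerE e subrr.
  have := max_poly_roots nz rws uws; apply/negP; rewrite -leqNgt.
  rewrite (leq_trans (size_polyD _ _)) // geq_max size_map_poly szS size_polyN.
  by rewrite (leq_trans (size_polyC_leq1 _)).
exists S`_0; have := congr1 (fun p : {poly F} => p`_0) S0.
by rewrite coefB coefC /= coef0 coef_map => /eqP; rewrite subr_eq0 => /eqP.
Qed.
End SimpleExtension.

(** * Artin-Schreier extensions *)

Section SameKernel.
Variables (R : comNzRingType) (F : fieldType) (e e' : {rmorphism R -> F}).
Hypothesis ker : forall r, e r = 0 <-> e' r = 0.
Hypothesis frac : forall u, exists a b, e b != 0 /\ u = e a / e b.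

Let num u := projT1 (cid (frac u)).
Let den u := projT1 (cid (projT2 (cid (frac u)))).
Let den_neq0 u : e (den u) != 0.
Proof. by rewrite /den; case: (cid (projT2 (cid (frac u)))) => ? [/=]. Qed.
Let fracE u : u = e (num u) / e (den u).
Proof. by rewrite /den /num; case: (cid (projT2 (cid (frac u)))) => ? [/=]. Qed.

(** F is the fraction field of the image of [e], and equality of kernels makes e r |-> e' r well
    defined. The numerators and denominators are arbitrary choices, on which the value does not
    depend by [kernel_hom_frac]. *)
Definition kernel_hom u := e' (num u) / e' (den u).

Let e'_neq0 r : e r != 0 -> e' r != 0.
Proof. by apply: contra_neq => /ker. Qed.

Lemma kernel_hom_frac a b : e b != 0 -> kernel_hom (e a / e b) = e' a / e' b.
Proof.
move=> bn0; rewrite /kernel_hom; set u := e a / e b.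
apply/eqP; rewrite eqr_div ?e'_neq0 // -!rmorphM -subr_eq0 -rmorphB.
apply/eqP/ker; rewrite rmorphB !rmorphM; apply/eqP; rewrite subr_eq0 -eqr_div //.
by rewrite -fracE.
Qed.

Lemma kernel_homE r : kernel_hom (e r) = e' r.
Proof.
by rewrite -[e r]divr1 -(rmorph1 e) kernel_hom_frac ?rmorph1 ?oner_eq0 // divr1.
Qed.

Lemma kernel_hom_zmod : zmod_morphism kernel_hom.
Proof.
move=> u v; rewrite {1}(fracE u) {1}(fracE v); have un0 := den_neq0 u.
have vn0 := den_neq0 v.
have -> : e (num u) / e (den u) - e (num v) / e (den v) =
    e (num u * den v - num v * den u) / e (den u * den v).
  by rewrite rmorphB !rmorphM; field; rewrite un0 vn0.
rewrite kernel_hom_frac ?rmorphM ?mulf_neq0 // /kernel_hom.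
rewrite rmorphB !rmorphM; field.
by rewrite !e'_neq0.
Qed.

Lemma kernel_hom_monoid : monoid_morphism kernel_hom.
Proof.
split=> [|u v]; first by rewrite -(rmorph1 e) kernel_homE !rmorph1.
rewrite {1}(fracE u) {1}(fracE v) mulf_div -!rmorphM kernel_hom_frac.
  by rewrite !rmorphM -mulf_div.
by rewrite rmorphM mulf_neq0.
Qed.

Lemma same_kernel_hom : exists sigma : {rmorphism F -> F}, forall r, sigma (e r) = e' r.
Proof.
pose f1 := GRing.isZmodMorphism.Build F F kernel_hom kernel_hom_zmod.
pose f2 := GRing.isMonoidMorphism.Build F F kernel_hom kernel_hom_monoid.
pose sigma : {rmorphism F -> F} := HB.pack kernel_hom f1 f2.
by exists sigma => r; apply: kernel_homE.
Qed.
End SameKernel.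

Lemma pnat_exp3 (R : nzRingType) n : 3%N \in [pchar R] -> [pchar R].-nat (3 ^ n)%N.
Proof. by move=> ch; rewrite pnatX pnatE ?ch. Qed.

Section XnsubX.
Variables (R : nzRingType) (n : nat).
Hypothesis n_gt1 : (1 < n)%N.

Lemma size_XnsubX : size ('X^n - 'X : {poly R}) = n.+1.
Proof. by rewrite size_polyDl size_polyXn // size_polyN size_polyX. Qed.

Lemma monic_XnsubX : 'X^n - 'X \is @monic R.
Proof.
by rewrite monicE lead_coefDl ?lead_coefXn // size_polyXn size_polyN size_polyX.
Qed.
End XnsubX.

Section ArtinSchreierRoots.
Variables (K : closedFieldType) (n : nat).
Hypothesis ch : 3%N \in [pchar K].
Hypothesis n_gt0 : (0 < n)%N.
Local Notation Q := (3 ^ n)%N.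

Lemma expr3n_eq0 : (Q%:R : K) = 0.
Proof.
by apply/eqP; rewrite -(dvdn_pcharf ch) dvdn_exp.
Qed.

(** The derivative of T^Q - T is -1 in characteristic 3, so the polynomial is separable; [rs] lists
    the subfield of K with Q elements. *)
Lemma artin_schreier_roots : exists rs : seq K, [/\ uniq rs, size rs = Q,
  'X^Q - 'X = \prod_(c <- rs) ('X - c%:P) & forall c, (c \in rs) = (c ^+ Q == c)].
Proof.
have Q1 : (1 < Q)%N by rewrite -{1}(exp1n n) ltn_exp2r.
have [szp mon] := (size_XnsubX K Q1, monic_XnsubX K Q1).
have [rs e] := closed_field_poly_normal ('X^Q - 'X : {poly K}).
move: e; rewrite (monicP mon) scale1r => e.
exists rs; split=> //.
- rewrite -separable_prod_XsubC -e unlock derivB derivXn derivX.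
  have -> : ('X^(Q.-1) *+ Q : {poly K}) = 0.
    by rewrite -mulr_natr -polyC_natr expr3n_eq0 mulr0.
  by rewrite sub0r -[- 1]scaleN1r coprimepZr ?coprimep1 // oppr_eq0 oner_eq0.
- by have := congr1 (fun p : {poly K} => size p) e; rewrite szp size_prod_XsubC => -[].
- by move=> c; rewrite -root_prod_XsubC -e rootE !hornerE subr_eq0.
Qed.
End ArtinSchreierRoots.

Lemma size_sub_monic (R : nzRingType) (p r : {poly R}) :
  p \is monic -> r \is monic -> size p = size r -> (size (p - r)%R < size p)%N.
Proof.
move=> mp mr e; have pn0 := monic_neq0 mp.
have szp : (0 < size p)%N by rewrite size_poly_gt0.
rewrite -(prednK szp) ltnS; apply/leq_sizeP => i; rewrite leq_eqVlt => /orP[/eqP<-|hi].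
  by rewrite coefB {2}e -/(lead_coef p) -/(lead_coef r) !(monicP _) ?subrr.
rewrite prednK // in hi.
by rewrite coefB !nth_default ?subrr // -e.
Qed.

(** * Additive polynomials and an irreducibility criterion *)

Section Additive.
Variable R : comNzRingType.
Definition additive_poly (a : {poly R}) :=
  forall p r : {poly R}, a \Po (p + r) = (a \Po p) + (a \Po r).

Lemma additive_poly0 a : additive_poly a -> a \Po 0 = 0.
Proof. move=> ad; have /eqP := ad 0 0.
by rewrite addr0 -subr_eq0 opprD addrA subrr sub0r oppr_eq0 => /eqP.
Qed.

Lemma additive_polyN a p : additive_poly a -> a \Po (- p) = - (a \Po p).
Proof.
by move=> ad; apply/eqP; rewrite -addr_eq0 -ad addNr additive_poly0.
Qed.
End Additive.

Section ArtinSchreier.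
Variables (K : closedFieldType) (L F : fieldType).
Variables (i : {rmorphism K -> L}) (j : {rmorphism L -> F}).
Variables (n : nat) (w : F) (g : L).
Hypothesis ch : 3%N \in [pchar K].
Hypothesis n_gt0 : (0 < n)%N.
Local Notation Q := (3 ^ n)%N.
Hypothesis wQ : w ^+ Q - w = j g.
Let iota : {rmorphism K -> F} := (j \o i : K -> F).

Let chP : 3%N \in [pchar {poly K}]. Proof. by rewrite pchar_poly. Qed.
Let Q_gt1 : (1 < Q)%N. Proof. by rewrite -{1}(exp1n n) ltn_exp2r. Qed.

Let PQ : {poly K} := 'X^Q - 'X.
Let PQ_monic : PQ \is monic. Proof. exact: monic_XnsubX. Qed.
Let PQ_size : size PQ = Q.+1. Proof. exact: size_XnsubX. Qed.

Let PQ_shift c : c ^+ Q = c -> PQ \Po ('X + c%:P) = PQ.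
Proof.
move=> e; rewrite /PQ comp_polyB comp_Xn_poly comp_polyX.
rewrite exprDn_pchar ?pnat_exp3 // -polyC_exp e; ring.
Qed.

(** The roots of [a] form a subgroup V of the field with Q elements, and a(w) in L means that every
    conjugate of w over L lies in w + V. *)
Definition additive_divisor (a : {poly K}) := [/\ a \is monic, additive_poly a, a %| PQ &
  exists e : L, (map_poly iota a).[w] = j e].

Let coprimepDC (a : {poly K}) (c d : K) : c != d -> coprimep (a + c%:P) (a + d%:P).
Proof.
move=> cd; have nz : (c - d) != 0 by rewrite subr_eq0.
apply/Bezout_coprimepP; exists ((c - d)^-1%:P, - (c - d)^-1%:P) => /=.
have -> : (c - d)^-1%:P * (a + c%:P) + - (c - d)^-1%:P * (a + d%:P) =
    ((c - d)^-1 * (c - d))%:P by rewrite polyCM polyCB; ring.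
by rewrite mulVf // eqpxx.
Qed.

(* Enlarging the kernel of a one step at a time, until it has index 3 in the
   kernel of 'X^Q - 'X: then 'X^Q - 'X = a ^+ 3 - d ^+ 2 *: a. *)
Lemma additive_divisor_extend k a : additive_divisor a -> (size a <= Q)%N -> (Q - size a < k)%N ->
  exists2 d : K, d != 0 & exists h : L, h ^+ 3 - i d ^+ 2 * h = g.
Proof.
elim: k a => [//|k IH] a [mona ada divA [e ae]] sza szk.
have [rs [urs szrs _ rsP]] := artin_schreier_roots ch n_gt0.
(* [a] has degree below Q, so it cannot vanish on the whole field with Q elements. *)
have [c cQ dn0] : exists2 c, c ^+ Q = c & a.[c] != 0.
  have [/allP h|/allPn[c]] := boolP (all (root a) rs); last first.
    by rewrite rsP => /eqP cQ ac; exists c.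
  have /allP h' : {in rs, forall c, root a c} by [].
  have := max_poly_roots (monic_neq0 mona) h' urs.
  by rewrite szrs ltnNge sza.
set d := a.[c] in dn0.
have shiftE b : a \Po ('X + b%:P) = a + (a.[b])%:P.
  by rewrite ada comp_polyXr comp_polyCr.
have divB b : b ^+ Q = b -> (a + (a.[b])%:P) %| PQ.
  by move=> eb; rewrite -shiftE -(PQ_shift eb) dvdp_comp_poly.
have aN : a.[- c] = - d.
  have := additive_polyN c%:P ada; rewrite -polyCN !comp_polyCr -polyCN.
  by move/polyC_inj.
(* With d = a(c) this is a (a + d) (a - d), the product of the translates of [a] by 0, c and -c; its
   kernel is V + F_3 c. *)
pose a' := a ^+ 3 - d ^+ 2 *: a.
have dd : d != - d.
  rewrite -subr_eq0 opprK -mulr2n -mulr_natr mulf_neq0 //.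
  by rewrite -(dvdn_pcharf ch).
have diva' : a' %| PQ.
  have -> : a' = (a + 0%:P) * ((a + d%:P) * (a + (- d)%:P)).
    by rewrite /a' -mul_polyC polyCN polyC_exp; ring.
  rewrite Gauss_dvdp; last by rewrite coprimepMr !coprimepDC // eq_sym ?oppr_eq0.
  rewrite addr0 divA Gauss_dvdp ?coprimepDC // /d divB // -/d -aN divB //.
  by rewrite exprNn_pchar ?pnat_exp3 ?cQ.
have a_gt0 : (0 < size a)%N by rewrite size_poly_gt0 monic_neq0.
have sza1 : (1 < size a)%N.
  rewrite ltnNge; apply/negP=> /size1_polyC ea; have := additive_poly0 ada.
  rewrite ea comp_polyC => /eqP; rewrite polyC_eq0 => /eqP a0.
  by move: dn0; rewrite /d ea a0 horner0 eqxx.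
have sza3 : size (a ^+ 3) = ((size a).-1 * 3).+1.
  have nz : (0 < size (a ^+ 3)%R)%N by rewrite size_poly_gt0 expf_neq0 ?monic_neq0.
  by rewrite -(prednK nz) size_exp.
have szd : (size (- (d ^+ 2 *: a))%R < size (a ^+ 3))%N.
  rewrite size_polyN size_scale ?expf_neq0 // sza3 -{1}(prednK a_gt0) ltnS.
  by rewrite -[ltnLHS]muln1 ltn_pmul2l // -ltnS prednK.
have sza' : size a' = ((size a).-1 * 3).+1 by rewrite size_polyDl.
have mona' : a' \is monic.
  by rewrite monicE lead_coefDl // lead_coef_exp (monicP mona) expr1n.
have ada' : additive_poly a'.
  move=> p r; rewrite /a' !(comp_polyB, comp_polyZ, rmorphXn) /= ada.
  by rewrite exprDn_pchar ?(pnat_exp3 1) // scalerDr; ring.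
have a'w : (map_poly iota a').[w] = j (e ^+ 3 - i d ^+ 2 * e).
  rewrite /a' rmorphB rmorphXn /= map_polyZ !hornerE ae /=.
  by rewrite !(rmorphB, rmorphM, rmorphXn).
have [sza'Q|sza'Q] := leqP (size a') Q.
  apply: (IH a') => //; first by split=> //; exists (e ^+ 3 - i d ^+ 2 * e).
  have lt_a_a' : (size a < size a')%N.
    rewrite sza' -{1}(prednK a_gt0) ltnS -[ltnLHS]muln1.
    by rewrite ltn_pmul2l // -ltnS prednK.
  rewrite ltnS in szk; rewrite (leq_trans _ szk) // ltn_sub2l //.
  exact: leq_trans sza'Q.
(* The kernel is now everything: a' = T^Q - T, whose value at w is g on one side and e^3 - d^2 e on
   the other, where e = a(w). *)
exists d => //; exists e; apply: (fmorph_inj j); rewrite -a'w -wQ.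
have -> : a' = PQ.
  apply/eqP; rewrite -eqp_monic // -dvdp_size_eqp // PQ_size eqn_leq sza'Q.
  by rewrite -PQ_size dvdp_leq ?monic_neq0.
by rewrite rmorphB /= map_polyXn map_polyX !hornerE.
Qed.

Let chF : 3%N \in [pchar F].
Proof. by rewrite (rmorph_pchar iota). Qed.

(* The minimal polynomial of w is a(T - w), where the roots of a are the c such
   that w + c is conjugate to w. *)
Lemma additive_divisor_ex (p : {poly L}) : p != 0 -> root (map_poly j p) w ->
  (size p <= Q)%N -> exists2 a, additive_divisor a & (size a <= Q)%N.
Proof.
move=> pn0 rp szp; have [m mm [rm szm min]] := minimal_poly_ex pn0 rp.
have mn0 := monic_neq0 mm.
have [rs [urs szrs ers rsP]] := artin_schreier_roots ch n_gt0.
have mdiv : m %| 'X^Q - 'X - g%:P.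
  rewrite /dvdp; apply/eqP/min; last exact: ltn_modpN0.
  have : root (map_poly j ('X^Q - 'X - g%:P)) w.
    by rewrite !rmorphB /= map_polyXn map_polyX map_polyC rootE !hornerE wQ subrr.
  rewrite {1}(divp_eq ('X^Q - 'X - g%:P) m) rmorphD rmorphM !rootE !hornerE.
  by rewrite (rootP rm) mulr0 add0r.
have eF : map_poly j ('X^Q - 'X - g%:P) = \prod_(c <- rs) ('X - (w + iota c)%:P).
  transitivity (map_poly iota PQ \Po ('X - w%:P)).
    rewrite /PQ !rmorphB /= !map_polyXn !map_polyX map_polyC /= -wQ.
    rewrite comp_Xn_poly comp_polyX exprDn_pchar ?pnat_exp3 ?pchar_poly ?chF //.
    rewrite exprNn_pchar ?pnat_exp3 ?pchar_poly ?chF //.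
    by rewrite polyCB -polyC_exp; ring.
  rewrite /PQ ers map_prod_XsubC rmorph_prod; apply: eq_bigr => c _ /=.
  by rewrite rmorphB /= comp_polyX comp_polyC rmorphD; ring.
have /dvdp_prod_XsubC[s es] : map_poly j m %| \prod_(c <- rs) ('X - (w + iota c)%:P).
  by rewrite -eF dvdp_map.
set C := mask s rs in es.
have subC c : c \in C -> c ^+ Q = c by move/mem_mask; rewrite rsP => /eqP.
have {}es : map_poly j m = \prod_(c <- C) ('X - (w + iota c)%:P).
  by apply/eqP; rewrite -eqp_monic ?map_monic // monic_prod_XsubC.
pose a := \prod_(c <- C) ('X - c%:P).
have ma : a \is monic by apply: monic_prod_XsubC.
have ea : map_poly j m = map_poly iota a \Po ('X - w%:P).
  rewrite es /a map_prod_XsubC rmorph_prod; apply: eq_bigr => c _ /=.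
  by rewrite rmorphB /= comp_polyX comp_polyC rmorphD; ring.
have sza : size a = size m.
  rewrite -(size_map_poly j) es !size_prod_XsubC //.
exists a; last by rewrite sza (leq_trans szm).
have diva : a %| PQ.
  apply: uniq_roots_dvdp; last by rewrite uniq_rootsE mask_uniq.
  by apply/allP=> c /subC ec; rewrite rootE !hornerE ec subrr.
have sza1 : (1 < size a)%N.
  rewrite sza ltnNge; apply/negP=> /size1_polyC em; move: rm mn0.
  by rewrite em map_polyC rootC fmorph_eq0 => /eqP->; rewrite eqxx.
(* Since w + c is again a root of m, the polynomial m(T + c) - m, of smaller degree, kills w and
   therefore vanishes. *)
have shift c : c \in C -> a \Po ('X + c%:P) = a.
  move=> cC; have cQ := subC _ cC.
  have szX : size ('X + (i c)%:P : {poly L}) = 2 by rewrite size_XaddC.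
  have szmX : size (m \Po ('X + (i c)%:P)) = size m by rewrite size_comp_poly2.
  have mX : m \Po ('X + (i c)%:P) \is monic.
    by rewrite monicE lead_coef_comp ?szX // (monicP mm) lead_coefXaddC expr1n mulr1.
  have emX : m \Po ('X + (i c)%:P) = m.
    apply/eqP; rewrite -subr_eq0; apply/eqP/min; last first.
      by rewrite -szmX size_sub_monic.
    rewrite rmorphB /= rootE !hornerE map_comp_poly horner_comp.
    rewrite rmorphD /= map_polyX map_polyC !hornerE (rootP rm) subr0.
    rewrite -[_ == 0]/(root _ _) es -(big_map (fun c => w + iota c) xpredT
      (fun x => 'X - x%:P)) root_prod_XsubC; exact: map_f.
  have := congr1 (fun p => map_poly j p \Po ('X + w%:P)) emX.
  rewrite map_comp_poly rmorphD /= map_polyX map_polyC /= ea.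
  rewrite -!comp_polyA !(comp_polyB, comp_polyD, comp_polyC, comp_polyX).
  rewrite addrK addrAC addrK comp_polyXr => e.
  apply: (map_poly_inj iota).
  by rewrite -[RHS]e map_comp_poly rmorphD /= map_polyX map_polyC.
have roots c : c \in C -> a.[c] = 0.
  by move=> cC; apply/rootP; rewrite root_prod_XsubC.
have ada : additive_poly a.
  (* B = a(T + r) - a(T) - a(r) is taken as a polynomial in T over K[X]. Its degree is below that of
     [a], and by the invariance under shifts it vanishes at all roots of [a], so B = 0. *)
  move=> p1 r; pose A := map_poly polyC a.
  pose B := (A \Po ('X + r%:P)) - A - (a \Po r)%:P.
  suff : B = 0.
    move/(congr1 (fun P : {poly {poly K}} => P.[p1])); rewrite /B !hornerE.
    rewrite horner_comp !hornerE => /eqP; rewrite -addrA -opprD subr_eq0 => /eqP.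
    by rewrite /A -![_.[_]]/(_ \Po _).
  have szA : size A = size a by rewrite size_map_poly.
  have mA : A \is monic by rewrite map_monic.
  have szX : size ('X + r%:P : {poly {poly K}}) = 2 by rewrite size_XaddC.
  have szAX : size (A \Po ('X + r%:P)) = size A by rewrite size_comp_poly2.
  have mAX : A \Po ('X + r%:P) \is monic.
    by rewrite monicE lead_coef_comp ?szX // (monicP mA) lead_coefXaddC expr1n mulr1.
  have szB : (size B < size a)%N.
    rewrite (leq_ltn_trans (size_polyD _ _)) // gtn_max size_polyN.
    by rewrite -{1}szA -szAX size_sub_monic //= (leq_ltn_trans (size_polyC_leq1 _)).
  apply/eqP/negPn/negP=> Bn0.
  have rB : all (root B) (map polyC C).
    apply/allP=> _ /mapP[c cC ->]; rewrite rootE /B !hornerE horner_comp !hornerE.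
    rewrite /A horner_map /= roots // subr0.
    have -> : (map_poly polyC a).[c%:P + r] = (a \Po ('X + c%:P)) \Po r.
      by rewrite -comp_polyA comp_polyD comp_polyX comp_polyC addrC.
    by rewrite shift // subrr.
  have uC : uniq (map polyC C).
    by rewrite map_inj_uniq ?mask_uniq //; apply: polyC_inj.
  have := max_poly_roots Bn0 rB uC; rewrite size_map => /leq_ltn_trans/(_ szB).
  by rewrite /a size_prod_XsubC ltnn.
(* By additivity a(w) = - a(-w), and a(-w) is the value at 0 of m = a(T - w), which lies in L. *)
split=> //; exists (- m.[0]).
have -> : j (- m.[0]) = - (map_poly iota a).[- w].
  by rewrite rmorphN -horner_map rmorph0 ea horner_comp !hornerE.
have := congr1 (fun p => (map_poly iota p).[w]) (additive_polyN 'X ada).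
rewrite comp_polyXr map_comp_poly !rmorphN /= map_polyX !hornerE horner_comp.
by rewrite !hornerE => ->; rewrite opprK.
Qed.

(** Read contrapositively, an irreducibility criterion: T^Q - T - g is irreducible over L unless one
    of these cubic equations is solvable in L. *)
Theorem artin_schreier_descent (p : {poly L}) :
    p != 0 -> root (map_poly j p) w -> (size p <= Q)%N ->
  exists2 d : K, d != 0 & exists h : L, h ^+ 3 - i d ^+ 2 * h = g.
Proof.
move=> pn0 rp szp; have [a ka sza] := additive_divisor_ex pn0 rp szp.
exact: additive_divisor_extend ka sza (ltnSn _).
Qed.
End ArtinSchreier.

(** * Irreducibility of the Ree curve and homomorphisms *)

Section ReducedEquation.
Variables (K : closedFieldType).
Hypothesis ch : 3%N \in [pchar K].

Lemma closed_root_exp (n : nat) (a : K) : (0 < n)%N -> exists b, b ^+ n = a.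
Proof.
move=> n_gt0; have /closed_rootP[b] : size ('X^n - a%:P) != 1.
  by rewrite size_XnsubC // eqSS -lt0n.
by rewrite rootE !hornerE subr_eq0 => /eqP; exists b.
Qed.

Let chP : 3%N \in [pchar {poly K}]. Proof. by rewrite pchar_poly. Qed.

(** Modulo the additive group of all S^3 - S, a polynomial and its cube agree. *)
Lemma expr3n_telescope k (u : {poly K}) :
  exists S, u ^+ (3 ^ k) = u + (S ^+ 3 - S).
Proof.
elim: k => [|k [S e]]; first by exists 0; rewrite expr1 subr0 expr0n addr0.
exists (S + u ^+ (3 ^ k)); rewrite exprDn_pchar ?(pnat_exp3 1) // -exprM -expnSr.
by rewrite e; ring.
Qed.

Lemma size_cube_sub (H : {poly K}) : (1 < size (H ^+ 3 - H)%R)%N ->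
  size (H ^+ 3 - H) = ((size H).-1 * 3).+1.
Proof.
move=> h; have [szH|szH] := leqP (size H) 1.
  move: h; rewrite (size1_polyC szH) -polyC_exp -polyCB ltnNge.
  by rewrite size_polyC_leq1.
have H_gt0 : (0 < size H)%N by apply: ltn_trans szH.
have Hn0 : H != 0 by rewrite -size_poly_gt0.
have sz3 : size (H ^+ 3) = ((size H).-1 * 3).+1.
  have nz : (0 < size (H ^+ 3)%R)%N by rewrite size_poly_gt0 expf_neq0.
  by rewrite -(prednK nz) size_exp.
rewrite size_polyDl ?sz3 // size_polyN; move: szH.
by case: (size H) => [|[|m]] // _; lia.
Qed.

Variables (s q0 q : nat).
Hypothesis hs : (1 <= s)%N.
Hypothesis hq0 : q0 = (3 ^ s)%N.
Hypothesis hq : q = (3 * q0 ^ 2)%N.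

(* The right-hand sides of the equations of the curve; [ree_G c] is
   w ^+ (q ^ 2) - w for w = y + c * z when c ^+ q = - c. *)
Definition ree_f : {poly K} := 'X^q0 * ('X^q - 'X).
Definition ree_g : {poly K} := 'X^(2 * q0) * ('X^q - 'X).
Definition ree_G (c : K) : {poly K} :=
  ree_f + ree_f ^+ q + c *: (ree_g + ree_g ^+ q).

Lemma q_exp3 : q = (3 ^ (s + s).+1)%N.
Proof. by rewrite hq hq0 -expnM muln2 -addnn expnS. Qed.

Lemma pnat_q0 : [pchar K].-nat q0. Proof. by rewrite hq0 pnat_exp3. Qed.
Lemma pnat_qK : [pchar K].-nat q. Proof. by rewrite q_exp3 pnat_exp3. Qed.

Lemma q0_ge3 : (3 <= q0)%N.
Proof. by rewrite hq0 -{1}(expn1 3) leq_exp2l. Qed.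

(** The exponents 3 q0 + 2 and 3 q0 + 1 dominate the other two and are prime to 3, while a
    nonconstant H^3 - H has degree divisible by 3. *)
Lemma reduced_equation_no_root (b e b' e' : K) (H : {poly K}) :
  H ^+ 3 - H = b *: 'X^(3 * q0 + 1) + e *: 'X^(3 * q0 + 2)
               + b' *: 'X^(q0 + 1) + e' *: 'X^(2 * q0 + 1) ->
  b = 0 /\ e = 0.
Proof.
have q0_3 := q0_ge3.
have szX (c : K) n : (size (c *: 'X^n : {poly K}) <= n.+1)%N.
  by rewrite (leq_trans (size_scale_leq _ _)) ?size_polyXn.
have szX' (c : K) n : c != 0 -> size (c *: 'X^n : {poly K}) = n.+1.
  by move=> cn0; rewrite size_scale ?size_polyXn.
have szD (u v : {poly K}) n : (size u < n -> size v < n -> size (u + v)%R < n)%N.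
  by move=> hu hv; rewrite (leq_ltn_trans (size_polyD _ _)) // gtn_max hu.
move=> eH; have szH := @size_cube_sub H; rewrite eH in szH.
have e0 : e = 0.
  apply/eqP/negPn/negP=> en0; move: szH.
  rewrite [b *: _ + _]addrC -!addrA size_polyDl szX' //; first by lia.
  by apply: (szD); last apply: (szD); rewrite (leq_ltn_trans (szX _ _)) //; lia.
split=> //; apply/eqP/negPn/negP=> bn0; move: szH.
rewrite e0 scale0r addr0 -!addrA size_polyDl szX' //; first by lia.
by apply: (szD); rewrite (leq_ltn_trans (szX _ _)) //; lia.
Qed.

(** Scaling by beta = d^-3 turns the left side into h^3 - h, and reduction modulo S^3 - S leaves
    only small exponents. Up to a Frobenius power the two top coefficients are beta + beta^q and
    beta c + (beta c)^q = c (beta - beta^q); both vanish only if 2 beta = 0. *)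
Theorem ree_G_irreducible (c d : K) (H : {poly K}) :
  c != 0 -> c ^+ q = - c -> d != 0 -> H ^+ 3 - d ^+ 2 *: H = ree_G c -> False.
Proof.
move=> cn0 cq dn0 eH; set beta := d ^- 3.
have q_gt0 : (0 < q)%N by rewrite q_exp3 expn_gt0.
have q0_gt0 : (0 < q0)%N by rewrite hq0 expn_gt0.
(* The top monomials have exponents (k q0 + q) q = m q q0 with m = 3 q0 + k; reducing them to X^m
   requires a root of order q q0 of their coefficients. *)
have [b1 eb1] : exists b, b ^+ (q * q0) = beta.
  by apply: closed_root_exp; rewrite muln_gt0 q_gt0.
have [e1 ee1] : exists b, b ^+ (q * q0) = beta * c.
  by apply: closed_root_exp; rewrite muln_gt0 q_gt0.
set m1 := (3 * q0 + 1)%N; set m2 := (3 * q0 + 2)%N.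
(* Replacing u ^+ (3 ^ k) by u changes it by some S ^+ 3 - S only. *)
have key (a a1 : K) (k m : nat) : a1 ^+ (q * q0) = a ->
    (q0 * m = k * q0 + q)%N -> exists S : {poly K},
    a *: ('X^(k * q0) * ('X^q - 'X) + ('X^(k * q0) * ('X^q - 'X)) ^+ q) =
    (a1 + a1 ^+ q) *: 'X^m - (a1 ^+ q0 + a) *: 'X^(k * q0 + 1) + (S ^+ 3 - S).
  move=> ea em.
  have [S1 eS1] := expr3n_telescope s (a1 ^+ q *: 'X^m).
  have [S2 eS2] := expr3n_telescope ((s + s).+1 + s) (a1 *: 'X^m).
  have [S3 eS3] := expr3n_telescope (s + s).+1 (a1 ^+ q0 *: 'X^(k * q0 + 1)).
  move: eS1 eS2 eS3; rewrite expnD -q_exp3 -hq0 !exprZn -!exprM [(q0 * q)%N]mulnC ea.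
  rewrite [(m * q0)%N]mulnC em [(m * (q * q0))%N]mulnC -mulnA em => eS1 eS2 eS3.
  exists (S1 + S2 - S3).
  rewrite !(exprDn_pchar, exprNn_pchar) ?(pnat_exp3 1) //.
  have -> : 'X^(k * q0) * ('X^q - 'X) = 'X^(k * q0 + q) - 'X^(k * q0 + 1) :> {poly K}.
    by rewrite mulrBr -!exprD addn1 exprSr.
  rewrite exprDn_pchar ?exprNn_pchar ?(eq_pnat _ (pchar_poly K)) ?pnat_qK //.
  rewrite -!exprM [((k * q0 + q) * q)%N]mulnC.
  rewrite !(scalerDr, scalerN) eS1 eS2 eS3 !scalerDl; ring.
have [S1 eS1] := key _ _ 1%N (3 * q0 + 1)%N eb1 ltac:(by rewrite hq; ring).
have [S2 eS2] := key _ _ 2%N (3 * q0 + 2)%N ee1 ltac:(by rewrite hq; ring).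
have eG : beta *: ree_G c =
    beta *: (ree_f + ree_f ^+ q) + (beta * c) *: (ree_g + ree_g ^+ q).
  by rewrite /ree_G scalerDr scalerA.
have eH1 : (d^-1 *: H) ^+ 3 - d^-1 *: H = beta *: ree_G c.
  rewrite -eH scalerBr scalerA exprZn exprVn -/beta; congr (_ - _ *: _).
  by rewrite /beta; field.
rewrite eG /ree_f /ree_g -[q0 in 'X^q0]mul1n eS1 eS2 in eH1.
have [] := @reduced_equation_no_root (b1 + b1 ^+ q) (e1 + e1 ^+ q)
   (- (b1 ^+ q0 + beta)) (- (e1 ^+ q0 + beta * c)) (d^-1 *: H - (S1 + S2)).
  rewrite exprDn_pchar ?exprNn_pchar ?exprDn_pchar ?(pnat_exp3 1) //.
  move: eH1; set h := _ *: H => eH1.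
  have -> : h ^+ 3 = h ^+ 3 - h + h by rewrite subrK.
  by rewrite eH1 mul1n !scaleNr; ring.
move=> /(congr1 (fun u => u ^+ (q * q0))); rewrite expr0n muln_eq0.
rewrite !(gtn_eqF _) //= exprDn_pchar; last by rewrite pnatM pnat_qK pnat_q0.
rewrite exprAC eb1 => eb /(congr1 (fun u => u ^+ (q * q0))).
rewrite expr0n muln_eq0 !(gtn_eqF _) //= exprDn_pchar; last first.
  by rewrite pnatM pnat_qK pnat_q0.
rewrite exprAC ee1 exprMn cq => ee.
have bn0 : beta != 0 by rewrite invr_eq0 expf_neq0.
move: eb => /eqP; rewrite addrC addr_eq0 => /eqP eb; move: ee.
rewrite eb mulrNN -mulr2n -[_ *+ 2]mulr_natl => /eqP.
by rewrite !mulf_eq0 (negbTE bn0) (negbTE cn0) !orbF -(dvdn_pcharf ch).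
Qed.
End ReducedEquation.

(** * Evaluation at points of the curve and the resulting homomorphisms *)

Section Evaluation.
Variables (K F : fieldType) (iota : {rmorphism K -> F}).

Definition ev (x : F) : {rmorphism {poly K} -> F} :=
  horner_morph (fun c => mulrC x (iota c)).
Definition ev2 (x w : F) : {rmorphism {poly {poly K}} -> F} :=
  horner_morph (fun p => mulrC w (ev x p)).

Lemma evC x c : ev x c%:P = iota c. Proof. exact: horner_morphC. Qed.
Lemma evX x : ev x 'X = x. Proof. exact: horner_morphX. Qed.
Lemma ev2C x w p : ev2 x w p%:P = ev x p. Proof. exact: horner_morphC. Qed.
Lemma ev2X x w : ev2 x w 'X = w. Proof. exact: horner_morphX. Qed.

Lemma ev_eq0 x p : ~ algebraicOver iota x -> ev x p = 0 -> p = 0.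
Proof.
move=> tx e; apply/eqP/negPn/negP=> pn0; apply: tx.
by exists p => //; apply/eqP.
Qed.

Lemma ev_neq0 x p : ~ algebraicOver iota x -> p != 0 -> ev x p != 0.
Proof. by move=> tx; apply: contra_neq => /(ev_eq0 tx). Qed.

Lemma adjoin_frac (R : comNzRingType) (e : {rmorphism R -> F}) gs u :
  (forall k, exists r, iota k = e r) -> {in gs, forall g, exists r, g = e r} ->
  adjoin iota gs u -> exists a b, e b != 0 /\ u = e a / e b.
Proof.
move=> hK hgs; have one : e 1 != 0 by rewrite rmorph1 oner_eq0.
elim=> {u} [k|g /hgs[r ->]|u v _ [a [b [bn0 ->]]] _ [c [d [dn0 ->]]]|u _ [a [b [bn0 ->]]]
  |u v _ [a [b [bn0 ->]]] _ [c [d [dn0 ->]]]|u _ [a [b [bn0 ->]]]].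
- by have [r ->] := hK k; exists r, 1; rewrite rmorph1 divr1 oner_eq0.
- by exists r, 1; rewrite rmorph1 divr1 oner_eq0.
- exists (a * d + c * b), (b * d); rewrite rmorphD !rmorphM mulf_neq0 //.
  by split=> //; field; rewrite bn0 dn0.
- by exists (- a), b; rewrite rmorphN mulNr.
- by exists (a * c), (b * d); rewrite !rmorphM mulf_neq0 // mulf_div.
- have [->|an0] := eqVneq (e a) 0.
    by exists 0, 1; rewrite mul0r invr0 rmorph0 mul0r.
  by exists b, a; rewrite invf_div.
Qed.
End Evaluation.

Section Irreducibility.
Variables (K : closedFieldType) (F : fieldType) (iota : {rmorphism K -> F}).
Hypothesis ch : 3%N \in [pchar K].
Variables (s q0 q : nat).
Hypothesis hs : (1 <= s)%N.
Hypothesis hq0 : q0 = (3 ^ s)%N.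
Hypothesis hq : q = (3 * q0 ^ 2)%N.
Variable c : K.
Hypothesis cn0 : c != 0.
Hypothesis cq : c ^+ q = - c.

Lemma pchar_emb : 3%N \in [pchar F]. Proof. by rewrite (rmorph_pchar iota). Qed.
Lemma pnat_emb n : [pchar F].-nat (3 ^ n)%N.
Proof. by rewrite pnat_exp3 ?pchar_emb. Qed.
Let qn : [pchar F].-nat q. Proof. by rewrite (q_exp3 hq0 hq) pnat_emb. Qed.

(** K[x] is integrally closed: in lowest terms the denominator divides the cube of the numerator,
    hence is a constant. *)
Lemma rational_cubic_integral x (d : K) u (G : {poly K}) :
  ~ algebraicOver iota x -> adjoin iota [:: x] u ->
  u ^+ 3 - iota d ^+ 2 * u = ev iota x G ->
  exists H : {poly K}, H ^+ 3 - d ^+ 2 *: H = G.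
Proof.
move=> tx adu eu.
have [A [B [Bn0 eAB]]] : exists A B, ev iota x B != 0 /\ u = ev iota x A / ev iota x B.
  apply: adjoin_frac adu => [k|g]; first by exists k%:P; rewrite evC.
  by rewrite inE => /eqP->; exists 'X; rewrite evX.
have B0 : B != 0 by apply: contraNneq Bn0 => ->; rewrite rmorph0.
set g := gcdp A B; have gn0 : g != 0 by rewrite gcdp_eq0 negb_and B0 orbT.
set A' := A %/ g; set B' := B %/ g.
have eA : A = A' * g by rewrite divpK ?dvdp_gcdl.
have eB : B = B' * g by rewrite divpK ?dvdp_gcdr.
have cop : coprimep A' B' by apply: coprimep_div_gcd; rewrite B0 orbT.
have B'n0 : B' != 0 by apply: contraNneq B0 => h; rewrite eB h mul0r.
have [evg evB'] := (ev_neq0 tx gn0, ev_neq0 tx B'n0).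
have {}eAB : u = ev iota x A' / ev iota x B'.
  by rewrite eAB eA eB !rmorphM -mulf_div divff ?mulr1.
have e : A' ^+ 3 - d%:P ^+ 2 * A' * B' ^+ 2 = G * B' ^+ 3.
  apply/eqP; rewrite -subr_eq0; apply/eqP; apply: (ev_eq0 tx).
  rewrite !(rmorphB, rmorphM, rmorphXn) -eu eAB /= evC; field; exact: evB'.
have dvdB : B' %| A' ^+ 3.
  have -> : A' ^+ 3 = (G * B' ^+ 2 + d%:P ^+ 2 * A' * B') * B'.
    by rewrite -[LHS](subrK (d%:P ^+ 2 * A' * B' ^+ 2)) e; ring.
  exact: dvdp_mulIr.
have szB : size B' = 1.
  have : coprimep B' (A' ^+ 3) by rewrite coprimep_expr // coprimep_sym.
  by move=> /coprimepP/(_ B' (dvdpp _) dvdB); rewrite -size_poly_eq1 => /eqP.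
have [b bn0 eb] : exists2 b, b != 0 & B' = b%:P.
  exists B'`_0; last by apply: size1_polyC; rewrite szB.
  by apply: contraNneq B'n0 => h; rewrite (size1_polyC (eq_leq szB)) h.
exists (b^-1 *: A'); rewrite exprZn scalerA.
have -> : G = b ^- 3 *: (G * B' ^+ 3).
  by rewrite eb -polyC_exp mulrC mul_polyC scalerA mulVf ?expf_neq0 ?scale1r.
rewrite -e scalerBr exprVn; congr (_ - _).
rewrite eb -!polyC_exp [_ * (b ^+ 2)%:P]mulrC !mul_polyC !scalerA; congr (_ *: _).
by field.
Qed.

Variables (x y z : F).
Hypothesis tx : ~ algebraicOver iota x.
Hypothesis hP : ree_point q0 q x y z.
Local Notation w := (y + iota c * z).
Local Notation f := (ree_f K q0 q).
Local Notation g := (ree_g K q0 q).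

Lemma ree_w_q : w ^+ q = y + ev iota x f - iota c * (z + ev iota x g).
Proof.
rewrite exprDn_pchar // exprMn -rmorphXn cq rmorphN mulNr.
rewrite /ree_f /ree_g !rmorphM rmorphB /= !rmorphXn /= !evX.
by rewrite -(ree_point_y hP) -(ree_point_z hP) ![_ + (_ - _)]addrC !subrK.
Qed.

Lemma ree_w_q2 : w ^+ (q ^ 2) - w = ev iota x (ree_G q0 q c).
Proof.
have yq : y ^+ q = y + ev iota x f.
  rewrite /ree_f rmorphM rmorphB /= !rmorphXn /= !evX -(ree_point_y hP).
  by rewrite addrC subrK.
have zq : z ^+ q = z + ev iota x g.
  rewrite /ree_g rmorphM rmorphB /= !rmorphXn /= !evX -(ree_point_z hP).
  by rewrite addrC subrK.
rewrite -mulnn exprM ree_w_q exprDn_pchar // exprNn_pchar // exprMn -rmorphXn cq.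
rewrite !exprDn_pchar // rmorphN mulNr opprK yq zq /ree_G -mul_polyC.
by rewrite !(rmorphD, rmorphM, rmorphXn) /= evC; ring.
Qed.

Lemma ree_irreducible (r : {poly {poly K}}) :
  (size r <= q ^ 2)%N -> ev2 iota x w r = 0 -> r = 0.
Proof.
move=> szr er; apply/eqP/negPn/negP=> rn0.
have xin : adjoin iota [:: x] x by apply: adjoin_gen; rewrite mem_head.
(* Evaluation at x is factored through the field K(x), the base field of the descent. *)
have [xL exL] := (adjoin_embP iota [:: x] x).1 xin.
pose cst : {rmorphism K -> adjoin_field iota [:: x]} := adjoin_cst iota [:: x].
pose evL : {rmorphism {poly K} -> adjoin_field iota [:: x]} := ev cst xL.
pose j := adjoin_emb iota [:: x].
have jev p : j (evL p) = ev iota x p.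
  transitivity (j (map_poly cst p).[xL]); first by [].
  rewrite -horner_map -map_poly_comp -[j xL]/(adjoin_emb _ _ xL) -exL.
  by transitivity (map_poly iota p).[x]; first by congr (_.[_]); apply: eq_map_poly.
have q2E : (q ^ 2 = 3 ^ ((s + s).+1 * 2))%N by rewrite (q_exp3 hq0 hq) expnM.
have wG : w ^+ (3 ^ ((s + s).+1 * 2)) - w = j (evL (ree_G q0 q c)).
  by rewrite -q2E ree_w_q2 jev.
have evL0 p : evL p = 0 -> p = 0.
  by move=> ep; apply: (ev_eq0 tx); rewrite -jev ep rmorph0.
have pn0 : map_poly evL r != 0.
  apply: contraNneq rn0 => /polyP e; apply/eqP/polyP=> k.
  by have := e k; rewrite coef_map !coef0 => /evL0.
have rp : root (map_poly j (map_poly evL r)) w.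
  rewrite -map_poly_comp (eq_map_poly jev); apply/eqP; exact: er.
have szp : (size (map_poly evL r) <= 3 ^ ((s + s).+1 * 2))%N.
  by rewrite -q2E (leq_trans _ szr) // size_poly.
have [] := artin_schreier_descent cst ch _ wG pn0 rp szp; first by rewrite muln2.
move=> d dn0 [h eh]; have : adjoin iota [:: x] (j h) by apply/adjoin_embP; exists h.
have eu : j h ^+ 3 - iota d ^+ 2 * j h = ev iota x (ree_G q0 q c).
  by rewrite -jev -eh !(rmorphB, rmorphM, rmorphXn).
move=> /(rational_cubic_integral tx)/(_ eu)[H eH].
exact: (ree_G_irreducible ch hs hq0 hq cn0 cq dn0 eH).
Qed.

Definition ree_modulus : {poly {poly K}} := 'X^(q ^ 2) - 'X - (ree_G q0 q c)%:P.

Lemma ev2_modulus : ev2 iota x w ree_modulus = 0.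
Proof.
by rewrite /ree_modulus !rmorphB rmorphXn /= ev2X ev2C ree_w_q2 subrr.
Qed.

Lemma ree_modulus_monic : ree_modulus \is monic /\ size ree_modulus = (q ^ 2).+1.
Proof.
have q1 : (1 < q ^ 2)%N.
  by rewrite (q_exp3 hq0 hq) -expnM -{1}(exp1n ((s + s).+1 * 2)) ltn_exp2r ?muln2.
have sz : (size ('X + (ree_G q0 q c)%:P : {poly {poly K}})%R < (q ^ 2).+1)%N.
  by rewrite size_XaddC ltnS.
rewrite /ree_modulus -addrA -opprD; split.
  by rewrite monicE lead_coefDl ?lead_coefXn // size_polyXn size_polyN.
by rewrite size_polyDl size_polyXn // size_polyN.
Qed.

(** The modulus is monic, so division with remainder works over K[X], and the remainder is too short
    to vanish at w unless it is 0. The criterion does not mention the point: evaluations at any two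
    transcendental points have the same kernel. *)
Lemma ev2_eq0 (p : {poly {poly K}}) :
  ev2 iota x w p = 0 <-> Pdiv.Ring.rmodp p ree_modulus = 0.
Proof.
have [mm szm] := ree_modulus_monic.
rewrite {1}(Pdiv.RingMonic.rdivp_eq mm p) rmorphD rmorphM ev2_modulus mulr0 add0r.
split=> [|->]; last by rewrite rmorph0.
by apply: ree_irreducible; rewrite -ltnS -szm Pdiv.Ring.ltn_rmodpN0 // monic_neq0.
Qed.

(** Because c^q = - c, the terms in z cancel in w + w^q = 2 y + f - c g; with 2 = -1 this recovers
    y, and then z, as polynomials in x and w. *)
Definition ree_y_poly : {poly {poly K}} :=
  - ('X + 'X^q - f%:P + (c%:P * g)%:P).
Definition ree_z_poly : {poly {poly K}} := (c^-1)%:P%:P * ('X - ree_y_poly).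

Lemma ev2_y_poly : ev2 iota x w ree_y_poly = y.
Proof.
rewrite /ree_y_poly rmorphN !rmorphD rmorphN rmorphXn /= !ev2C ev2X ree_w_q.
rewrite [ev _ _ (c%:P * _)]rmorphM /= evC.
transitivity (y - (y + y + y)); first by ring.
have /eqP y3 : y *+ 3 = 0 by rewrite -mulr_natr pcharf0 ?mulr0 ?pchar_emb.
by move: y3; rewrite mulrS mulr2n addrA => /eqP->; rewrite subr0.
Qed.

Lemma ev2_z_poly : ev2 iota x w ree_z_poly = z.
Proof.
rewrite /ree_z_poly rmorphM rmorphB ev2_y_poly /= ev2C ev2X evC fmorphV.
by rewrite addrAC subrr add0r mulKf // fmorph_eq0.
Qed.
End Irreducibility.

Section Homomorphisms.
Variables (K : closedFieldType) (F : fieldType) (iota : {rmorphism K -> F}).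
Hypothesis ch : 3%N \in [pchar K].
Variables (s q0 q : nat).
Hypothesis hs : (1 <= s)%N.
Hypothesis hq0 : q0 = (3 ^ s)%N.
Hypothesis hq : q = (3 * q0 ^ 2)%N.

Lemma ree_conjugator : exists2 c : K, c != 0 & c ^+ q = - c.
Proof.
have q_gt1 : (1 < q)%N by rewrite (q_exp3 hq0 hq) -{1}(exp1n (s + s).+1) ltn_exp2r.
have [c ec] := @closed_root_exp K q.-1 (-1) ltac:(by rewrite -subn1 subn_gt0).
exists c; last by rewrite -(prednK (ltnW q_gt1)) exprS ec mulrN1.
apply: contra_eq_neq ec => ->; rewrite expr0n -subn1 subn_eq0 leqNgt q_gt1 /=.
by rewrite eq_sym oppr_eq0 oner_eq0.
Qed.

Theorem ree_hom (x y z x' y' z' : F) :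
    ~ algebraicOver iota x -> ree_point q0 q x y z ->
    (forall u, adjoin iota [:: x; y; z] u) ->
    ~ algebraicOver iota x' -> ree_point q0 q x' y' z' ->
  exists sigma : {rmorphism F -> F},
    [/\ forall k, sigma (iota k) = iota k, sigma x = x', sigma y = y' & sigma z = z'].
Proof.
move=> tx hP gen tx' hP'; have [c cn0 cq] := ree_conjugator.
have [|u|sigma esigma] := @same_kernel_hom _ _ (ev2 iota x (y + iota c * z))
   (ev2 iota x' (y' + iota c * z')).
- move=> r; rewrite (ev2_eq0 ch hs hq0 hq cn0 cq tx hP).
  by rewrite (ev2_eq0 ch hs hq0 hq cn0 cq tx' hP').
- apply: adjoin_frac (gen u) => [k|g]; first by exists k%:P%:P; rewrite ev2C evC.
  rewrite !inE => /or3P[] /eqP->.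
  + by exists 'X%:P; rewrite ev2C evX.
  + by exists (ree_y_poly q0 q c); rewrite (ev2_y_poly _ ch hq0 hq cq hP).
  + by exists (ree_z_poly q0 q c); rewrite (ev2_z_poly _ ch hq0 hq cn0 cq hP).
exists sigma; split=> [k|||].
- by have := esigma k%:P%:P; rewrite !ev2C !evC.
- by have := esigma 'X%:P; rewrite !ev2C !evX.
- have := esigma (ree_y_poly q0 q c).
  by rewrite (ev2_y_poly _ ch hq0 hq cq hP) (ev2_y_poly _ ch hq0 hq cq hP').
- have := esigma (ree_z_poly q0 q c).
  by rewrite (ev2_z_poly _ ch hq0 hq cn0 cq hP) (ev2_z_poly _ ch hq0 hq cn0 cq hP').
Qed.
End Homomorphisms.

(** * Automorphisms and the fixed field *)

Lemma adjoin_sub (K F : fieldType) (iota : {rmorphism K -> F}) gs gs' u :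
  {in gs, forall g, adjoin iota gs' g} -> adjoin iota gs u -> adjoin iota gs' u.
Proof.
move=> hgs; elim=> {u} [k|g|a b _ pa _ pb|a _ pa|a b _ pa _ pb|a _ pa].
- exact: adjoin_const.
- exact: hgs.
- exact: adjoinD.
- exact: adjoinN.
- exact: adjoinM.
- exact: adjoinV.
Qed.

Lemma adjoin_descent (K F : fieldType) (iota : {rmorphism K -> F}) gs w u
    (P : {poly adjoin_field iota gs}) (ws : seq F) :
  P != 0 -> root (map_poly (adjoin_emb iota gs) P) w -> adjoin iota (w :: gs) u ->
  uniq ws -> (size P <= (size ws).+1)%N ->
  {in ws, forall w', exists sigma : {rmorphism F -> F},
    [/\ sigma w = w', sigma u = u, forall k, sigma (iota k) = iota k &
        {in gs, forall g, sigma g = g}]} ->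
  adjoin iota gs u.
Proof.
move=> Pn0 rP adu uws szP hws; apply/adjoin_embP.
apply: (fixed_poly_value Pn0 rP) uws szP _ => [|w' /hws[sigma [ew eu hK hgs]]].
  apply: adjoin_poly_value adu; first by exists P.
    by move=> k; apply/adjoin_embP; apply: adjoin_const.
  move=> g; rewrite inE => /predU1P[->|gin]; first exact: poly_value_gen.
  have /adjoin_embP[l ->] := adjoin_gen iota gin; exact: poly_value_const.
exists sigma; split=> // l; apply: (adjoin_fixed hK hgs).
by apply/adjoin_embP; exists l.
Qed.

(** u is a root of the monic polynomial P - a, whose coefficients are integral over L; integrality
    is transitive. *)
Lemma algebraic_shift (L F : fieldType) (j : {rmorphism L -> F}) (P : {poly L}) a u :
  P \is monic -> (1 < size P)%N -> algebraicOver j a ->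
  (map_poly j P).[u] = a -> algebraicOver j u.
Proof.
move=> mP szP /integral_algebraic alga e; apply/integral_algebraic.
apply: (@integral_root_monic _ _ _ _ (map_poly j P - a%:P)).
- rewrite monicE lead_coefDl ?size_map_poly ?size_polyN ?lead_coef_map.
    by rewrite (monicP mP) rmorph1.
  by rewrite (leq_ltn_trans (size_polyC_leq1 _)).
- by rewrite rootE !hornerE e subrr.
- apply/integral_poly=> k; rewrite coefB coef_map coefC.
  by apply: integral_sub; [apply: integral_id|case: ifP => // _; apply: integral0].
Qed.

(* sigma permutes the finitely many roots of a polynomial killing u. *)
Lemma algebraic_bijective (L F : fieldType) (j : {rmorphism L -> F})
    (sigma : {rmorphism F -> F}) :
  (forall u, algebraicOver j u) -> (forall l, sigma (j l) = j l) -> bijective sigma.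
Proof.
move=> alg hL; have inj_s := fmorph_inj sigma.
have surj u : exists v, sigma v = u.
  have [p pn0 rp] := alg u.
  pose us := traject sigma u (size p).
  have rus : all (root (map_poly j p)) us.
    apply/allP=> _ /trajectP[k _ ->]; elim: k => [//|k IH] /=.
    have -> : map_poly j p = map_poly sigma (map_poly j p).
      by rewrite -map_poly_comp; apply: eq_map_poly => l; rewrite /= hL.
    by rewrite fmorph_root.
  have : ~~ uniq us.
    apply/negP=> uus; have := max_poly_roots _ rus uus.
    by rewrite map_poly_eq0 size_map_poly size_traject ltnn => /(_ pn0).
  case/(uniqPn u) => i [k []]; rewrite size_traject => lik lk.
  rewrite !nth_traject ?(ltn_trans lik) // -(subnKC (ltnW lik)) iterD => e.
  have {}e : u = iter (k - i) sigma u.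
    by move: (iter (k - i) sigma u) e => v; elim: (i) => [//|m IH] /= /inj_s /IH.
  by exists (iter (k - i.+1) sigma u); rewrite -iterS subnSK // -e.
exists (fun u => projT1 (cid (surj u))) => u; case: cid => v //= e.
exact: inj_s.
Qed.

Lemma ree_exponents q0 q : (3 <= q0)%N -> (9 * q0 <= q)%N ->
  [/\ (6 * q0 < q)%N, (3 * q0 < q)%N & (3 < q)%N] /\
  [/\ (6 * q0 == 3 * q0)%N = false, (3 * q0 == 3)%N = false,
      (6 * q0 == 3)%N = false, (6 * q0 == 0)%N = false & (3 * q0 == 0)%N = false].
Proof. by move=> h1 h2; split; split; lia. Qed.

Section ReeField.
Variables (s q0 q : nat).
Hypothesis hs : (1 <= s)%N.
Hypothesis hq0 : q0 = (3 ^ s)%N.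
Hypothesis hq : q = (3 * q0 ^ 2)%N.
Variables (K : closedFieldType) (F : fieldType) (iota : {rmorphism K -> F}).
Hypothesis ch : 3%N \in [pchar K].
Variables (x y z : F).
Hypothesis hF : ree_function_field iota q0 q x y z.

Let tx : ~ algebraicOver iota x. Proof. exact: ree_x_transcendental hF. Qed.
Let hP : ree_point q0 q x y z. Proof. by case: hF => _ hy hz _; split. Qed.
Let gen : forall u, adjoin iota [:: x; y; z] u. Proof. exact: ree_generated hF. Qed.
Let chF : 3%N \in [pchar F]. Proof. exact: (pchar_emb iota ch). Qed.
Let q0n : [pchar F].-nat q0. Proof. by rewrite hq0 (pnat_emb iota ch). Qed.
Let qn : [pchar F].-nat q. Proof. by rewrite (q_exp3 hq0 hq) (pnat_emb iota ch). Qed.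
Let q0_3 : (3 <= q0)%N. Proof. exact: q0_ge3 hs hq0. Qed.
Let q_ge : (9 * q0 <= q)%N.
Proof. by rewrite hq -mulnn; nia. Qed.
Let q_gt1 : (1 < q)%N. Proof. by lia. Qed.

Add Ring F3_ring : (r3_theory F)
  (morphism (f3_morph chF), constants [r3_constant], power_tac (r3_power F) [r3_nat]).

Local Notation D := (x ^+ q - x).
Local Notation theta := (ree_theta q x).
Local Notation t := (ree_t q0 q x).

Let cst_neq0 k : x != iota k.
Proof. by apply/eqP=> e; apply: tx; rewrite e; apply: algebraic_id. Qed.

Let lin_inj a b a' b' : iota a * x + iota b = iota a' * x + iota b' -> a = a' /\ b = b'.
Proof.
move=> e; have ea : a = a'.
  apply/eqP/negPn/negP=> ne; have nz : iota (a - a') != 0.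
    by rewrite fmorph_eq0 subr_eq0.
  case/eqP: (cst_neq0 ((b' - b) / (a - a'))).
  rewrite fmorph_div; apply: (mulIf nz); rewrite divfK // !rmorphB.
  apply/eqP; rewrite -subr_eq0; move/eqP: e; rewrite -subr_eq0 => /eqP<-.
  by apply/eqP; ring.
by split=> //; move: e; rewrite ea => /addrI/fmorph_inj.
Qed.

Let D_neq0 : D != 0.
Proof.
have : ev iota x ('X^q - 'X) != 0.
  by apply: (ev_neq0 tx); rewrite monic_neq0 ?monic_XnsubX.
by rewrite rmorphB rmorphXn /= evX.
Qed.
Let theta_neq0 : theta != 0. Proof. by rewrite expf_neq0. Qed.

Let B0 (R : nzRingType) : (ree_B R q0 q).[0] = 1.
Proof.
rewrite /ree_B !(hornerD, hornerN, hornerXn) -polyC1 hornerC !expr0n !addn_eq0.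
by rewrite expn_eq0 !(gtn_eqF (ltnW q_gt1)) /= oppr0 !addr0.
Qed.

Let j := (q - 3 * q0 + 1)%N.
(** The first factor, the degree of B_R, is (q+1)(q+3q0+1); and (q+1)^2 - (3q0)^2 = q^2 - q + 1
    because 9 q0^2 = 3 q. *)
Let degE : ((q ^ 2 + 3 * q0 * q + 2 * q + 3 * q0 + 1) * j = q ^ 3 + 1)%N.
Proof.
rewrite /j hq; case: q0 q0_3 => // p _.
have -> : (3 * p.+1 ^ 2 - 3 * p.+1 = 3 * p * p.+1)%N.
  by rewrite -mulnn -[(3 * p.+1)%N]muln1 mulnA -mulnBr subn1 /= mulnAC.
by ring.
Qed.

Lemma size_ree_B (R : nzRingType) :
  (size (ree_B R q0 q) <= (q ^ 2 + 3 * q0 * q + 2 * q + 3 * q0 + 1).+1)%N.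
Proof.
have szD (u v : {poly R}) n : (size u <= n -> size v <= n -> size (u + v)%R <= n)%N.
  by move=> hu hv; rewrite (leq_trans (size_polyD _ _)) // geq_max hu.
rewrite /ree_B; do 6!(apply: (szD); last by rewrite ?size_polyN size_polyXn; lia).
by rewrite size_poly1.
Qed.

(** The definition of t_R with the denominator cleared: for l = t_R, a polynomial over K(t_R) with
    root theta, nonzero because B_R(0) = 1. *)
Definition ree_t_poly (L : fieldType) (l : L) : {poly L} :=
  ree_B L q0 q ^+ j - l%:P * 'X^(q ^ 3).

Lemma ree_t_poly_neq0 (L : fieldType) (l : L) : ree_t_poly l != 0.
Proof.
apply/eqP=> /(congr1 (fun p => p.[0])).
rewrite /ree_t_poly hornerD hornerN hornerM hornerC hornerXn horner_exp B0 expr1n expr0n expn_eq0 (gtn_eqF (ltnW q_gt1)) /=.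
by rewrite mulr0 subr0 horner0 => /eqP; rewrite oner_eq0.
Qed.

Lemma size_ree_t_poly (L : fieldType) (l : L) : (size (ree_t_poly l) <= (q ^ 3 + 1).+1)%N.
Proof.
rewrite /ree_t_poly (leq_trans (size_polyD _ _)) // geq_max; apply/andP; split.
  rewrite (leq_trans (size_poly_exp_leq _ _)) // ltnS -degE leq_mul2r.
  by apply/orP; right; rewrite -subn1 leq_subLR add1n size_ree_B.
rewrite size_polyN mul_polyC (leq_trans (size_scale_leq _ _)) // size_polyXn.
by rewrite addn1.
Qed.

Lemma map_ree_B (L M : fieldType) (f : {rmorphism L -> M}) :
  map_poly f (ree_B L q0 q) = ree_B M q0 q.
Proof. by rewrite /ree_B !(rmorphD, rmorphN) /= rmorph1 !map_polyXn. Qed.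

Lemma root_ree_t_poly (L : fieldType) (f : {rmorphism L -> F}) l :
  f l = t -> root (map_poly f (ree_t_poly l)) theta.
Proof.
move=> el; rewrite /ree_t_poly rmorphB rmorphM rmorphXn /= map_ree_B map_polyXn.
rewrite map_polyC /= el rootE hornerD hornerN hornerM horner_exp hornerC hornerXn.
rewrite /ree_t divfK ?subrr //.
by rewrite expf_neq0.
Qed.

Lemma x_algebraic (L : fieldType) (f : {rmorphism L -> F}) l :
  f l = t -> algebraicOver f x.
Proof.
move=> el; have q1 : (0 < q - 1)%N by rewrite subn_gt0.
have [sz mon] := (size_XnsubX L q_gt1, monic_XnsubX L q_gt1).
apply: (@algebraic_shift _ _ f (('X^q - 'X) ^+ (q - 1)) theta).
- exact: monic_exp.
- have nz : (0 < size (('X^q - 'X : {poly L}) ^+ (q - 1))%R)%N.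
    by rewrite size_poly_gt0 monic_neq0 ?monic_exp.
  by rewrite -(prednK nz) size_exp sz ltnS muln_gt0 (ltnW q_gt1).
- by exists (ree_t_poly l); [exact: ree_t_poly_neq0|exact: root_ree_t_poly].
- by rewrite rmorphXn rmorphB /= map_polyXn map_polyX !hornerE.
Qed.

Lemma ree_algebraic (L : fieldType) (f : {rmorphism L -> F}) l :
  f l = t -> (forall k, exists l', iota k = f l') -> forall u, algebraicOver f u.
Proof.
move=> el hK u.
have ax := x_algebraic el.
have aX n : algebraicOver f (x ^+ n).
  elim: n => [|n IH]; first by rewrite expr0; apply: algebraic1.
  by rewrite exprS; apply: algebraic_mul.
have [sz mon] := (size_XnsubX L q_gt1, monic_XnsubX L q_gt1).
have ash a b : b ^+ q - b = a -> algebraicOver f a -> algebraicOver f b.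
  move=> e aa; apply: (algebraic_shift mon _ aa); first by rewrite sz ltnS ltnW.
  by rewrite rmorphB /= map_polyXn map_polyX !hornerE.
have aD n : algebraicOver f (x ^+ n * D) by apply/algebraic_mul/algebraic_sub.
elim: (gen u) => {u} [k|g|a b _ pa _ pb|a _ pa|a b _ pa _ pb|a _ pa].
- by have [l' ->] := hK k; apply: algebraic_id.
- rewrite !inE => /or3P[] /eqP-> //.
    exact: (ash _ _ (ree_point_y hP)).
  exact: (ash _ _ (ree_point_z hP)).
- exact: algebraic_add.
- exact: algebraic_opp.
- exact: algebraic_mul.
- exact: algebraic_inv.
Qed.

Lemma t_transcendental k : iota k = t -> False.
Proof. by move/x_algebraic. Qed.

Lemma automorphism_of_hom (sigma : {rmorphism F -> F}) :
  (forall k, sigma (iota k) = iota k) -> sigma t = t -> is_Kautomorphism iota sigma.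
Proof.
move=> hK et; split=> //.
have tin : adjoin iota [:: t] t by apply: adjoin_gen; rewrite mem_head.
have [l el] := (adjoin_embP iota [:: t] t).1 tin.
apply: (algebraic_bijective (j := adjoin_emb iota [:: t])) => [|l'].
  apply: ree_algebraic (esym el) _ => k.
  by apply/adjoin_embP; apply: adjoin_const.
apply: (adjoin_fixed hK (gs := [:: t])) => [g|]; first by rewrite inE => /eqP->.
by apply/adjoin_embP; exists l'.
Qed.

Lemma rmorph_theta (L M : fieldType) (f : {rmorphism L -> M}) u :
  f (ree_theta q u) = ree_theta q (f u).
Proof. by rewrite /ree_theta rmorphXn rmorphB rmorphXn. Qed.

Lemma rmorph_t (L M : fieldType) (f : {rmorphism L -> M}) u :
  f (ree_t q0 q u) = ree_t q0 q (f u).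
Proof.
rewrite /ree_t -rmorph_theta; move: (ree_theta q u) => th.
by rewrite fmorph_div !rmorphXn -horner_map map_ree_B.
Qed.

(** * The affine automorphisms *)

Let affine_x a b := iota a * x + iota b.
Let affine_y a b c := iota (a ^+ (q0 + 1)) * y + iota (a * b ^+ q0) * x + iota c.
Let affine_z a b d := iota (a ^+ (2 * q0 + 1)) * z
  - iota (a ^+ (q0 + 1) * b ^+ q0) * y + iota (a * b ^+ (2 * q0)) * x + iota d.

Let iota_q a : a ^+ q = a -> iota a ^+ q = iota a.
Proof. by move=> e; rewrite -rmorphXn e. Qed.

Let affine_D a b : a ^+ q = a -> b ^+ q = b ->
  affine_x a b ^+ q - affine_x a b = iota a * D.
Proof.
move=> ea eb; rewrite /affine_x exprDn_pchar // exprMn !iota_q //; ring.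
Qed.

Let affine_theta a b : a != 0 -> a ^+ q = a -> b ^+ q = b ->
  ree_theta q (affine_x a b) = theta.
Proof.
move=> an0 ea eb; rewrite /ree_theta affine_D // exprMn.
have -> : iota a ^+ (q - 1) = 1; last by rewrite mul1r.
have ian0 : iota a != 0 by rewrite fmorph_eq0.
by apply: (mulfI ian0); rewrite -exprS subn1 prednK ?(ltnW q_gt1) // iota_q ?mulr1.
Qed.

Lemma affine_point a b c d : a ^+ q = a -> b ^+ q = b -> c ^+ q = c -> d ^+ q = d ->
  ree_point q0 q (affine_x a b) (affine_y a b c) (affine_z a b d).
Proof.
move=> ea eb ec ed; have [hy hz] := hP.
have yq : y ^+ q = y + x ^+ q0 * D by rewrite -hy addrC subrK.
have zq : z ^+ q = z + (x ^+ q0) ^+ 2 * D.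
  by rewrite -exprM [(q0 * 2)%N]mulnC -hz addrC subrK.
have xq : x ^+ q = x + D by rewrite addrC subrK.
have fix_q (k : K) : k ^+ q = k -> forall n, (k ^+ n) ^+ q = k ^+ n.
  by move=> ek n; rewrite exprAC ek.
have fix_qM (k l : K) : k ^+ q = k -> l ^+ q = l -> (k * l) ^+ q = k * l.
  by move=> ek el; rewrite exprMn ek el.
split; rewrite affine_D // ?[x in LHS]/affine_x.
  rewrite /affine_y /affine_x !exprDn_pchar // !exprMn !iota_q ?fix_qM ?fix_q // xq yq.
  rewrite addn1 exprS !rmorphM !rmorphXn.
  by move: (iota a) (iota b) => A B; move: (x ^+ q0) (D) => X d'; ring.
have -> : affine_x a b ^+ (2 * q0) = (iota a ^+ q0 * x ^+ q0 + iota b ^+ q0) ^+ 2.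
  by rewrite mulnC exprM /affine_x exprDn_pchar // exprMn.
set S := (_ + _) ^+ 2; have eS : S = (iota a ^+ q0 * x ^+ q0 + iota b ^+ q0) ^+ 2 by [].
move: S eS => S eS; rewrite /affine_z !exprDn_pchar // exprNn_pchar // !exprMn.
rewrite !iota_q ?fix_qM ?fix_q // xq yq zq [(2 * q0)%N]mulnC.
rewrite eS !addn1 !exprS !exprM !rmorphM !rmorphXn.
move: (iota a) (iota b) (iota d) => A B C; move: (x ^+ q0) (D) => X d'.
(* The two sides differ by three times this cross term; the [ring] called here ignores the
   characteristic, so 3 u = 0 is supplied by hand. *)
set u := A * A ^+ q0 * B ^+ q0 * X * d'.
have u3 : u + u + u = 0.
  have := mulr_natr u 3; rewrite (pcharf0 chF) mulr0 !mulrS mulr0n addr0 addrA.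
  by move=> ->.
rewrite -[RHS]subr0 -u3 /u; ring.
Qed.

Lemma affine_automorphism a b c d :
  a != 0 -> a ^+ q = a -> b ^+ q = b -> c ^+ q = c -> d ^+ q = d ->
  exists sigma : {rmorphism F -> F}, [/\ forall k, sigma (iota k) = iota k,
    [/\ sigma x = affine_x a b, sigma y = affine_y a b c & sigma z = affine_z a b d],
    sigma theta = theta & ree_group iota q0 q x y z sigma].
Proof.
move=> an0 ea eb ec ed.
have tx' : ~ algebraicOver iota (affine_x a b).
  move=> ax; apply: tx; have -> : x = (affine_x a b - iota b) / iota a.
    by rewrite /affine_x addrK mulrC mulKf // fmorph_eq0.
  apply: algebraic_div; last exact: algebraic_id.
  by apply: algebraic_sub => //; apply: algebraic_id.
have [sigma [hK ex ey ez]] :=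
  ree_hom ch hs hq0 hq tx hP gen tx' (affine_point ea eb ec ed).
have eth : sigma theta = theta.
  by rewrite rmorph_theta ex affine_theta.
have et : sigma t = t.
  by rewrite rmorph_t /ree_t -rmorph_theta eth.
have aut := automorphism_of_hom hK et.
exists sigma; split=> //; apply: ree_affine aut _.
by exists a, b, c, d; split.
Qed.


Lemma translation b c d : b ^+ q = b -> c ^+ q = c -> d ^+ q = d ->
  exists sigma : {rmorphism F -> F}, [/\ forall k, sigma (iota k) = iota k,
    [/\ sigma x = x + iota b, sigma y = y + iota (b ^+ q0) * x + iota c
      & sigma z = z - iota (b ^+ q0) * y + iota (b ^+ (2 * q0)) * x + iota d],
    sigma theta = theta & ree_group iota q0 q x y z sigma].
Proof.
move=> eb ec ed; have one_q : (1 : K) ^+ q = 1 by rewrite expr1n.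
have [sigma [hK [ex ey ez] eth gr]] := affine_automorphism (oner_neq0 K) one_q eb ec ed.
exists sigma; split=> //; split; rewrite ?ex ?ey ?ez.
- by rewrite /affine_x rmorph1 mul1r.
- by rewrite /affine_y expr1n rmorph1 !mul1r.
- by rewrite /affine_z !expr1n rmorph1 !mul1r.
Qed.

Lemma translation_yz c d : c ^+ q = c -> d ^+ q = d ->
  exists sigma : {rmorphism F -> F}, [/\ forall k, sigma (iota k) = iota k,
    [/\ sigma x = x, sigma y = y + iota c & sigma z = z + iota d]
    & ree_group iota q0 q x y z sigma].
Proof.
have zero_q : (0 : K) ^+ q = 0 by rewrite expr0n (gtn_eqF (ltnW q_gt1)).
have q0_gt0 : (0 < q0)%N by apply: leq_trans q0_3.
move=> ec ed; have [sigma [hK [ex ey ez] _ gr]] := translation zero_q ec ed.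
exists sigma; split=> //; split; rewrite ?ex ?ey ?ez.
- by rewrite rmorph0 addr0.
- by rewrite expr0n (gtn_eqF q0_gt0) rmorph0 mul0r addr0.
- by rewrite !expr0n muln_eq0 (gtn_eqF q0_gt0) /= rmorph0 !mul0r subr0 addr0.
Qed.

(* As a polynomial in z this relation has degree below q, but it is preserved by
   the q translations z |-> z + d. *)
Lemma cubic_relation A B C E :
  adjoin iota [:: x; y] A -> adjoin iota [:: x; y] B -> adjoin iota [:: x; y] C ->
  adjoin iota [:: x; y] E ->
  A * z ^+ (6 * q0) + B * z ^+ (3 * q0) + C * z ^+ 3 + E = 0 ->
  [/\ A = 0, B = 0 & C = 0].
Proof.
move=> hA hB hC hE e0.
pose p := A *: 'X^(6 * q0) + B *: 'X^(3 * q0) + C *: 'X^3 + E%:P.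
have [rs [urs szrs _ rsP]] := artin_schreier_roots ch (ltn0Sn (s + s)).
rewrite -(q_exp3 hq0 hq) in szrs rsP.
have zero_q : (0 : K) ^+ q = 0 by rewrite expr0n (gtn_eqF (ltnW q_gt1)).
have rp : all (root p) [seq z + iota d | d <- rs].
  apply/allP=> w /mapP[d]; rewrite rsP => /eqP ed ->.
  have [sigma [hK [ex ey ez] _]] := translation_yz zero_q ed.
  have fix_xy u : adjoin iota [:: x; y] u -> sigma u = u.
    apply: adjoin_fixed hK _ u => g; rewrite !inE => /orP[] /eqP-> //.
    by rewrite ey rmorph0 addr0.
  rewrite /p rootE !(hornerD, hornerZ, hornerXn) hornerC -ez.
  rewrite -(fix_xy A) // -(fix_xy B) // -(fix_xy C) // -(fix_xy E) //.
  by rewrite -!rmorphXn -!rmorphM -!rmorphD e0 rmorph0.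
have urs' : uniq [seq z + iota d | d <- rs].
  by rewrite map_inj_uniq // => d d' /addrI /fmorph_inj.
have [[q6 q3 qq] [n63 n33 n6 n60 n30]] := ree_exponents q0_3 q_ge.
have p0 : p = 0.
  apply/eqP/negPn/negP=> pn0; have := max_poly_roots pn0 rp urs'.
  rewrite size_map szrs; apply/negP; rewrite -leqNgt.
  have szD (u v : {poly F}) : (size u <= q -> size v <= q -> size (u + v)%R <= q)%N.
    by move=> hu hv; rewrite (leq_trans (size_polyD _ _)) // geq_max hu.
  have szX (c : F) n : (n < q -> size (c *: 'X^n) <= q)%N.
    by move=> h; rewrite (leq_trans (size_scale_leq _ _)) ?size_polyXn.
  rewrite /p; do 3!(apply: (szD); last by
    [apply: szX|rewrite (leq_trans (size_polyC_leq1 _)) // ltnW]).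
  exact: szX.
have coefp n : A * (n == 6 * q0)%:R + B * (n == 3 * q0)%:R + C * (n == 3)%:R
    + E * (n == 0)%:R = 0.
  have := congr1 (fun r : {poly F} => r`_n) p0.
  rewrite /p !coefD !coefZ !coefXn coefC coef0; case: n => [|n] //=.
    by rewrite mulr1.
  by rewrite mulr0.
split.
- by have := coefp (6 * q0)%N; rewrite eqxx n6 n60 n63 mulr1 !mulr0 !addr0.
- have := coefp (3 * q0)%N; rewrite eqxx n33 n30 eq_sym n63.
  by rewrite mulr1 !mulr0 !addr0 add0r.
- have := coefp 3%N; rewrite eqxx ![3%N == _]eq_sym n6 n33.
  by rewrite mulr1 !mulr0 !addr0 !add0r.
Qed.

(** * Translates of w8 *)

Let shift_y b c := y + iota (b ^+ q0) * x + iota c.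
Let shift_e b d := - (iota (b ^+ q0) * y) + iota (b ^+ (2 * q0)) * x + iota d.
(** The image of w8 under the translation (a = 1) with parameters b, c, d. The shift of z is kept
    apart because it lies in K(x, y), so that W is a polynomial in z over that field. *)
Let W b c d := ree_w8 q0 (x + iota b) (shift_y b c) (z + shift_e b d).

Let adj_x : x \in adjoined iota [:: x; y].
Proof. by apply/adjoinedP/adjoin_gen; rewrite !inE eqxx. Qed.
Let adj_y : y \in adjoined iota [:: x; y].
Proof. by apply/adjoinedP/adjoin_gen; rewrite !inE eqxx orbT. Qed.
Let adj_k k : iota k \in adjoined iota [:: x; y].
Proof. exact/adjoinedP/adjoin_const. Qed.
Let adj_shift_y b c : shift_y b c \in adjoined iota [:: x; y].
Proof. by rewrite !(rpredD, rpredM). Qed.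
Let adj_shift_e b d : shift_e b d \in adjoined iota [:: x; y].
Proof. by rewrite !(rpredD, rpredN, rpredM). Qed.

Lemma rmorph_w8 (sigma : {rmorphism F -> F}) a b c :
  sigma (ree_w8 q0 a b c) = ree_w8 q0 (sigma a) (sigma b) (sigma c).
Proof.
rewrite /ree_w8 /ree_w7 /ree_w5 /ree_v /ree_w3 /ree_w2 /ree_w1.
by rewrite !(rmorphD, rmorphN, rmorphM, rmorphXn).
Qed.

Lemma translation_w8 b c d : b ^+ q = b -> c ^+ q = c -> d ^+ q = d ->
  exists sigma : {rmorphism F -> F}, [/\ forall k, sigma (iota k) = iota k,
    sigma theta = theta, sigma (ree_w8 q0 x y z) = W b c d,
    ree_point q0 q (x + iota b) (shift_y b c) (z + shift_e b d)
    & ree_group iota q0 q x y z sigma].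
Proof.
move=> eb ec ed; have [sigma [hK [ex ey ez] eth gr]] := translation eb ec ed.
have ez' : sigma z = z + shift_e b d by rewrite ez /shift_e !addrA.
exists sigma; split=> //; first by rewrite rmorph_w8 ex ey ez'.
have [hy hz] := hP; split.
  have := congr1 sigma hy; rewrite rmorphB !rmorphM rmorphB !rmorphXn /= ex ey.
  by [].
have := congr1 sigma hz; rewrite rmorphB !rmorphM rmorphB !rmorphXn /= ex ez'.
by [].
Qed.

(** By w8 = (w5^q0)^3 + x (w7^q0)^3, z enters only through z^(6 q0), z^(3 q0) and z^3, the shape
    required by [cubic_relation]. *)
Lemma W_expand b c d : b ^+ q = b -> c ^+ q = c -> d ^+ q = d ->
  exists2 C, C \in adjoined iota [:: x; y] &
  W b c d = z ^+ (6 * q0)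
    + ((x + iota b) * shift_y b c ^+ (3 * q0) - shift_e b d ^+ (3 * q0)) * z ^+ (3 * q0)
    - (x + iota b) * z ^+ 3 + C.
Proof.
move=> eb ec ed; have [_ [_ _ _ hP1 _]] := translation_w8 eb ec ed.
rewrite /W; move: (shift_y b c) (shift_e b d) (adj_shift_y b c) (adj_shift_e b d) hP1.
have : x + iota b \in adjoined iota [:: x; y] by rewrite rpredD.
move: (x + iota b) => x1 ax1 y1 e ay1 ae hP1.
pose X := x1 ^+ q0; pose Y := y1 ^+ q0; pose e' := e ^+ q0.
exists (e' ^+ 6 + x1 * Y ^+ 3 * e' ^+ 3 - x1 * e ^+ 3
        - (Y * (x1 * X - y1)) ^+ 3 + x1 * (X * y1 - X * (x1 * X - y1)) ^+ 3).
  by rewrite !(rpredD, rpredN, rpredM, rpredX).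
rewrite ree_w8E (ree_w5_q0 chF q0n hq hP1) (ree_w7_q0 chF q0n hq hP1) -/X -/Y.
rewrite (exprDn_pchar z e q0n).
have -> : z ^+ (6 * q0) = (z ^+ q0) ^+ 6 by rewrite mulnC exprM.
rewrite ![_ ^+ (3 * q0)]expr_3q0 -/e' -/Y.
by rewrite /X /Y /e'; move: (z ^+ q0) (e ^+ q0) (x1 ^+ q0) (y1 ^+ q0) => *; ring3_in F.
Qed.

(** Coefficients in z are compared: z^(6 q0) forces k = 1, z^3 forces b = b', and z^(3 q0) leaves (x
    + b)(c - c')^(3 q0) + (d' - d)^(3 q0) = 0, which is linear in the transcendental x. *)
Lemma W_relation b c d b' c' d' k : b ^+ q = b -> c ^+ q = c -> d ^+ q = d ->
  b' ^+ q = b' -> c' ^+ q = c' -> d' ^+ q = d' ->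
  W b c d = iota k * W b' c' d' -> [/\ b = b', c = c' & d = d'].
Proof.
move=> eb ec ed eb' ec' ed'; have [C hC ->] := W_expand eb ec ed.
have [C' hC' ->] := W_expand eb' ec' ed' => /eqP; rewrite -subr_eq0 => /eqP e0.
set B1 := (x + iota b) * _ - _ in e0; set B2 := (x + iota b') * _ - _ in e0.
have [] := @cubic_relation (1 - iota k) (B1 - iota k * B2)
  (- (x + iota b) + iota k * (x + iota b')) (C - iota k * C').
- by apply/adjoinedP; rewrite rpredB // rpred1.
- by apply/adjoinedP; rewrite /B1 /B2 !(rpredB, rpredN, rpredD, rpredM, rpredX).
- by apply/adjoinedP; rewrite !(rpredB, rpredN, rpredD, rpredM, rpredX).
- by apply/adjoinedP; rewrite !(rpredB, rpredN, rpredD, rpredM, rpredX).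
- by rewrite -e0; ring.
move=> /eqP; rewrite subr_eq0 => /eqP <-; rewrite !mul1r => eB.
rewrite opprD addrACA addNr add0r addrC => /eqP; rewrite subr_eq0 => /eqP/fmorph_inj ebb.
subst b'.
have {}eB : (x + iota b) * (shift_y b c ^+ (3 * q0) - shift_y b c' ^+ (3 * q0))
    + (shift_e b d' ^+ (3 * q0) - shift_e b d ^+ (3 * q0)) = 0.
  by rewrite -eB /B1 /B2; ring.
move: eB.
have q0n3 : [pchar F].-nat (3 * q0)%N by rewrite pnatM pnat3.
have -> : shift_y b c ^+ (3 * q0) - shift_y b c' ^+ (3 * q0) =
    iota ((c - c') ^+ (3 * q0)).
  rewrite -exprNn_pchar // -exprDn_pchar // rmorphXn rmorphB /shift_y; congr (_ ^+ _).
  by ring.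
have -> : shift_e b d' ^+ (3 * q0) - shift_e b d ^+ (3 * q0) =
    iota ((d' - d) ^+ (3 * q0)).
  rewrite -exprNn_pchar // -exprDn_pchar // rmorphXn rmorphB /shift_e; congr (_ ^+ _).
  by ring.
set u := (c - c') ^+ _; set v := (d' - d) ^+ _ => e1.
have n3 : (3 * q0 == 0)%N = false by case: (ree_exponents q0_3 q_ge) => _ [].
have [u0 v0] : u = 0 /\ b * u + v = 0.
  apply: lin_inj; rewrite rmorph0 mul0r addr0 rmorphD rmorphM.
  by rewrite -e1; ring.
split=> //; apply/eqP; rewrite -subr_eq0.
  by move/eqP: u0; rewrite expf_eq0 => /andP[].
by move/eqP: v0; rewrite u0 mulr0 add0r expf_eq0 => /andP[_]; rewrite -opprB oppr_eq0.
Qed.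

Lemma W_not_constant b c d k : b ^+ q = b -> c ^+ q = c -> d ^+ q = d ->
  W b c d != iota k.
Proof.
move=> eb ec ed; have [C hC ->] := W_expand eb ec ed.
apply/negP; rewrite -subr_eq0 => /eqP e0; set B := (x + iota b) * _ - _ in e0.
have [] := @cubic_relation 1 B (- (x + iota b)) (C - iota k).
- by apply/adjoinedP; rewrite rpred1.
- by apply/adjoinedP; rewrite /B !(rpredB, rpredN, rpredD, rpredM, rpredX).
- by apply/adjoinedP; rewrite !(rpredN, rpredD).
- by apply/adjoinedP; rewrite rpredB.
- by rewrite -e0; ring.
by move=> /eqP; rewrite oner_eq0.
Qed.

Let zero_q : (0 : K) ^+ q = 0.
Proof. by rewrite expr0n (gtn_eqF (ltnW q_gt1)). Qed.

Lemma w8_neq0 : ree_w8 q0 x y z != 0.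
Proof.
have [sigma [hK _ ew _ _]] := translation_w8 zero_q zero_q zero_q.
by rewrite -(fmorph_eq0 sigma) ew -(rmorph0 iota) W_not_constant.
Qed.

Lemma involution_automorphism : exists phi : {rmorphism F -> F},
  [/\ forall k, phi (iota k) = iota k,
      phi theta = theta / ree_w8 q0 x y z ^+ (j * (q - 1)),
      phi t = t & ree_group iota q0 q x y z phi].
Proof.
have q0_gt0 : (0 < q0)%N by apply: leq_trans q0_3.
have hP' := ree_involution_point chF q0n hq hP w8_neq0.
have et := ree_t_involution chF q0n hq hP w8_neq0 q0_gt0 D_neq0.
(* If the image of x were a constant, t_R, which has the same value there, would be a constant as
   well. *)
have tx' : ~ algebraicOver iota (ree_w6 q0 x y z / ree_w8 q0 x y z).
  move=> /algebraic_over_closed[k ek]; apply: (@t_transcendental (ree_t q0 q k)).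
  by rewrite rmorph_t -ek.
have [phi [hK ex ey ez]] := ree_hom ch hs hq0 hq tx hP gen tx' hP'.
have et' : phi t = t by rewrite rmorph_t ex.
exists phi; split=> //.
  by rewrite rmorph_theta ex (ree_theta_involution chF q0n hq hP w8_neq0 q0_gt0).
by apply: ree_involution; [exact: automorphism_of_hom|split].
Qed.

Lemma same_power u v n :
  (0 < n)%N -> v != 0 -> u ^+ n = v ^+ n -> exists k, u = iota k * v.
Proof.
move=> n_gt0 vn0 e; have [|k ek] := @algebraic_over_closed _ _ iota (u / v).
  exists ('X^n - 1); first by rewrite -size_poly_eq0 size_XnsubC.
  rewrite rmorphB /= map_polyXn rmorph1 rootE !hornerE expr_div_n e divff ?subrr //.
  exact: expf_neq0.
by exists k; rewrite -ek divfK.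
Qed.

(* K(theta) has degree q ^ 3 + 1 over K(t), and theta and the
   theta / W b c d ^+ J are q ^ 3 + 1 distinct conjugates of theta. *)
Lemma rational_invariant u : adjoin iota [:: theta] u ->
  fixed_by (ree_group iota q0 q x y z) u -> adjoin iota [:: t] u.
Proof.
move=> hu fix_u; have [rs [urs szrs _ rsP]] := artin_schreier_roots ch (ltn0Sn (s + s)).
rewrite -(q_exp3 hq0 hq) in szrs rsP.
have [tl etl] : exists l, t = adjoin_emb iota [:: t] l.
  by apply/adjoin_embP/adjoin_gen; rewrite mem_head.
pose J := (j * (q - 1))%N.
have J_gt0 : (0 < J)%N by rewrite /J muln_gt0 /j addn1 subn_gt0.
pose bs := [seq (b, c) | b <- rs, c <- rs].
pose ps := [seq (p, d) | p <- bs, d <- rs].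
have psP p : p \in ps -> [/\ p.1.1 ^+ q = p.1.1, p.1.2 ^+ q = p.1.2 & p.2 ^+ q = p.2].
  move=> /allpairsP[[[b c] d] /= [/allpairsP[[b' c'] /= [hb hc [-> ->]]] hd ->]] /=.
  by move: hb hc hd; rewrite !rsP => /eqP ? /eqP ? /eqP.
pose T (p : K * K * K) := theta / W p.1.1 p.1.2 p.2 ^+ J.
have Wn0 p : p \in ps -> W p.1.1 p.1.2 p.2 != 0.
  by move=> /psP[h1 h2 h3]; rewrite -(rmorph0 iota) W_not_constant.
have ups : uniq (theta :: map T ps).
  rewrite /= map_inj_in_uniq; last first.
    move=> p p' hp hp' /(mulfI theta_neq0)/invr_inj.
    move=> /(same_power J_gt0 (Wn0 p' hp'))[k].
    have [h1 h2 h3] := psP _ hp; have [h1' h2' h3'] := psP _ hp'.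
    move=> /(W_relation h1 h2 h3 h1' h2' h3'); case: p {hp h1 h2 h3} => [[? ?] ?].
    by case: p' {hp' h1' h2' h3'} => [[? ?] ?] /= [-> -> ->].
  rewrite !allpairs_uniq // ?andbT; try by move=> [? ?] [? ?] _ _ [-> ->].
  apply/negP=> /mapP[p hp]; rewrite /T => e.
  have e1 : W p.1.1 p.1.2 p.2 ^+ J = 1 ^+ J.
    rewrite expr1n; apply: invr_inj; apply: (mulfI theta_neq0).
    by rewrite -e invr1 mulr1.
  have [k ek] := same_power J_gt0 (oner_neq0 F) e1.
  have [h1 h2 h3] := psP _ hp.
  by have := @W_not_constant p.1.1 p.1.2 p.2 k h1 h2 h3; rewrite ek mulr1 eqxx.
apply: (@adjoin_descent _ _ iota [:: t] theta u (ree_t_poly tl) (theta :: map T ps)).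
- exact: ree_t_poly_neq0.
- exact/root_ree_t_poly/esym.
- apply: adjoin_sub hu => g; rewrite inE => /eqP->; apply: adjoin_gen.
  by rewrite mem_head.
- exact: ups.
- rewrite (leq_trans (size_ree_t_poly _)) // ltnS /= size_map !size_allpairs szrs.
  by rewrite addn1 ltnS !expnS expn0 muln1 mulnA.
move=> w; rewrite inE => /predU1P[->|/mapP[p hp ->]].
  by exists idfun; split=> // g.
have [h1 h2 h3] := psP _ hp.
have [phi [hK eth et gr]] := involution_automorphism.
have [sigma [hK' eth' ew _ gr']] := translation_w8 h1 h2 h3.
(* phi acts first and divides theta by w8^J; the translation then fixes theta and replaces w8 by its
   translate W. *)
exists (sigma \o phi : {rmorphism F -> F}); split => [| |k|g] /=.
- by rewrite eth fmorph_div rmorphXn eth' ew.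
- by rewrite (fix_u _ gr) (fix_u _ gr').
- by rewrite hK hK'.
- rewrite inE => /eqP->; rewrite et rmorph_t /ree_t -rmorph_theta eth'.
  by [].
Qed.

Let AS_poly (L : fieldType) (l : L) : {poly L} := 'X^q - 'X - l%:P.
Let AS_poly_size (L : fieldType) (l : L) : size (AS_poly l) = q.+1.
Proof.
have sz : (size ('X + l%:P : {poly L})%R < q.+1)%N by rewrite size_XaddC ltnS.
by rewrite /AS_poly -addrA -opprD size_polyDl size_polyXn // size_polyN.
Qed.
Let AS_poly_neq0 (L : fieldType) (l : L) : AS_poly l != 0.
Proof. by rewrite -size_poly_eq0 AS_poly_size. Qed.
Let AS_poly_root (L : fieldType) (f : {rmorphism L -> F}) l u :
  u ^+ q - u = f l -> root (map_poly f (AS_poly l)) u.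
Proof.
move=> e; rewrite /AS_poly !rmorphB /= map_polyXn map_polyX map_polyC.
by rewrite rootE !hornerE /= e subrr.
Qed.

Let theta_poly (L : fieldType) (l : L) : {poly L} := ('X^q - 'X) ^+ (q - 1) - l%:P.
Let theta_poly_size (L : fieldType) (l : L) : size (theta_poly l) = (q * (q - 1)).+1.
Proof.
have szA := size_XnsubX L q_gt1.
have An0 : ('X^q - 'X : {poly L}) != 0 by rewrite -size_poly_eq0 szA.
have nz : (0 < size (('X^q - 'X : {poly L}) ^+ (q - 1))%R)%N.
  by rewrite size_poly_gt0 expf_neq0.
have szAq : size (('X^q - 'X : {poly L}) ^+ (q - 1)) = (q * (q - 1)).+1.
  by rewrite -(prednK nz) size_exp szA.
rewrite /theta_poly size_polyDl szAq // size_polyN.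
rewrite (leq_ltn_trans (size_polyC_leq1 _)) //.
by rewrite ltnS muln_gt0 (ltnW q_gt1) subn_gt0.
Qed.
Let theta_poly_root (L : fieldType) (f : {rmorphism L -> F}) l :
  theta = f l -> root (map_poly f (theta_poly l)) x.
Proof.
move=> e; rewrite /theta_poly rmorphB rmorphXn rmorphB /= map_polyXn map_polyX.
by rewrite map_polyC /= -e rootE hornerD hornerN horner_exp !hornerE subrr.
Qed.

Let adj_sub gs gs' u : {subset gs <= gs'} -> adjoin iota gs u -> adjoin iota gs' u.
Proof. by move=> sub; apply: adjoin_sub => g /sub; apply: adjoin_gen. Qed.

Let adj_gen gs g : g \in gs -> g \in adjoined iota gs.
Proof. by move=> h; apply/adjoinedP/adjoin_gen. Qed.

(** * Descent of an invariant from F to K(theta) *)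

Section Fixed.
Variable u : F.
Hypothesis fix_u : fixed_by (ree_group iota q0 q x y z) u.

Let fixed_xy : adjoin iota [:: x; y] u.
Proof.
have [rs [urs szrs _ rsP]] := artin_schreier_roots ch (ltn0Sn (s + s)).
rewrite -(q_exp3 hq0 hq) in szrs rsP.
have [l el] : exists l, x ^+ (2 * q0) * D = adjoin_emb iota [:: x; y] l.
  by apply/adjoin_embP/adjoinedP; rewrite rpredM ?rpredB ?rpredX.
apply: (@adjoin_descent _ _ _ _ z u (AS_poly l) [seq z + iota d | d <- rs]) => //.
- exact: AS_poly_neq0.
- by apply: (@AS_poly_root _ (adjoin_emb iota [:: x; y]) l); rewrite -el (ree_point_z hP).
- apply: adj_sub (gen u) => g; rewrite !inE => /or3P[] ->; by rewrite ?orbT.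
- by rewrite map_inj_uniq // => d d' /addrI /fmorph_inj.
- by rewrite AS_poly_size size_map szrs.
move=> w /mapP[d]; rewrite rsP => /eqP ed ->.
have [sigma [hK [ex ey ez] gr]] := translation_yz zero_q ed.
exists sigma; split=> // [|g]; first exact: fix_u.
by rewrite !inE => /orP[] /eqP->; rewrite ?ex ?ey ?rmorph0 ?addr0.
Qed.

Let fixed_x : adjoin iota [:: x] u.
Proof.
have [rs [urs szrs _ rsP]] := artin_schreier_roots ch (ltn0Sn (s + s)).
rewrite -(q_exp3 hq0 hq) in szrs rsP.
have ax : x \in adjoined iota [:: x] by rewrite adj_gen ?mem_head.
have [l el] : exists l, x ^+ q0 * D = adjoin_emb iota [:: x] l.
  by apply/adjoin_embP/adjoinedP; rewrite rpredM ?rpredB ?rpredX.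
apply: (@adjoin_descent _ _ _ _ y u (AS_poly l) [seq y + iota c | c <- rs]) => //.
- exact: AS_poly_neq0.
- by apply: (@AS_poly_root _ (adjoin_emb iota [:: x]) l); rewrite -el (ree_point_y hP).
- by apply: adj_sub fixed_xy => g; rewrite !inE => /orP[] ->; rewrite ?orbT.
- by rewrite map_inj_uniq // => d d' /addrI /fmorph_inj.
- by rewrite AS_poly_size size_map szrs.
move=> w /mapP[c]; rewrite rsP => /eqP ec ->.
have [sigma [hK [ex ey ez] gr]] := translation_yz ec zero_q.
exists sigma; split=> // [|g]; first exact: fix_u.
by rewrite !inE => /eqP->.
Qed.

Lemma fixed_theta : adjoin iota [:: theta] u.
Proof.
have [rs [urs szrs _ rsP]] := artin_schreier_roots ch (ltn0Sn (s + s)).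
rewrite -(q_exp3 hq0 hq) in szrs rsP.
have [l el] : exists l, theta = adjoin_emb iota [:: theta] l.
  by apply/adjoin_embP/adjoin_gen; rewrite mem_head.
have r0 : 0 \in rs by rewrite rsP zero_q.
(* The q (q - 1) conjugates a x + b of x over K(theta), with a = 0 removed; their number is the
   degree of (T^q - T)^(q-1). *)
pose ws := [seq iota a * x + iota b | a <- rem 0 rs, b <- rs].
have hrem a : (a \in rem 0 rs) = (a != 0) && (a ^+ q == a).
  by rewrite (mem_rem_uniq _ urs) !inE rsP.
apply: (@adjoin_descent _ _ _ _ x u (theta_poly l) ws) => //.
- by rewrite -size_poly_eq0 theta_poly_size.
- exact: (@theta_poly_root _ (adjoin_emb iota [:: theta])).
- by apply: adj_sub fixed_x => g; rewrite !inE => ->.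
- apply: allpairs_uniq => //; first exact: rem_uniq.
  by move=> [a b] [a' b'] _ _ /= /lin_inj[-> ->].
- by rewrite theta_poly_size size_allpairs size_rem // szrs subn1 mulnC.
move=> w /allpairsP[[a b] /= []]; rewrite hrem => /andP[an0 /eqP ea].
rewrite rsP => /eqP eb ->.
have [sigma [hK [ex ey ez] eth gr]] := affine_automorphism an0 ea eb zero_q zero_q.
exists sigma; split=> // [|g]; first exact: fix_u.
by rewrite !inE => /eqP->.
Qed.
End Fixed.

(** Elements of the group are bare functions, so only the generators are treated as field morphisms;
    composites and inverses follow by induction with u arbitrary. *)
Lemma adjoin_t_fixed f u : ree_group iota q0 q x y z f -> adjoin iota [:: t] u -> f u = u.
Proof.
have key (sigma : {rmorphism F -> F}) : is_Kautomorphism iota sigma -> sigma t = t ->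
    forall v, adjoin iota [:: t] v -> sigma v = v.
  move=> [_ hK] et; apply: adjoin_fixed => // g; by rewrite inE => /eqP->.
move=> gr; elim: gr u => {f} [sigma aut [a [b [c [d [[an0 ea eb _ _] ex _ _]]]]]
  |sigma aut [ex _ _]| |f g _ IHf _ IHg|f g _ IHf fg gf] u hu //=.
- by apply: key hu => //; rewrite rmorph_t /ree_t ex affine_theta.
- apply: key hu => //; rewrite rmorph_t ex.
  have q0_gt0 : (0 < q0)%N by apply: leq_trans q0_3.
  exact: (ree_t_involution chF q0n hq hP w8_neq0 q0_gt0 D_neq0).
- by rewrite IHg ?IHf.
- by rewrite -{1}(IHf u hu) fg.
Qed.

Lemma ree_fixed_field u :
  fixed_by (ree_group iota q0 q x y z) u <-> adjoin iota [:: t] u.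
Proof.
split=> [fix_u|hu f gr]; last exact: adjoin_t_fixed gr hu.
by apply: rational_invariant => //; apply: fixed_theta.
Qed.
End ReeField.

Theorem theorem4p8 (s q0 q : nat) (hs : (1 <= s)%N)
  (hq0 : q0 = (3 ^ s)%N) (hq : q = (3 * q0 ^ 2)%N)
  (K : closedFieldType) (charK : 3%N \in [pchar K])
  (F : fieldType) (iota : {rmorphism K -> F}) (x y z : F)
  (hF : ree_function_field iota q0 q x y z) :
  forall u : F,
    fixed_by (ree_group iota q0 q x y z) u <->
    adjoin iota [:: ree_t q0 q x] u.
Proof. by move=> u; apply: (@ree_fixed_field s q0 q). Qed.
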